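(* Let $a>0$ and $\delta\ge0$ be such that $2a+\delta<1$. Let $(u_n)_{n\in\mathbb{N}}$ be a $\delta$-sublacunary sequence of real numbers and let $(I_n)_{n\in\mathbb{N}}$ be a sequence of subsets of $[0,1]$ such that $\lambda(I_n)=n^{-a}$ for every $n$ and there is $\ell\in\mathbb{N}$ such that each $I_n$ is a union of at most $\ell$ intervals. Then, for $\lambda$-almost every $y\in[0,1]$, the sequence of integers $$\{n\in\mathbb{N}:\ \{u_ny\}\in I_n\}=\{a_1(y)<a_2(y)<\cdots\}$$ is pointwise universally $L^2$-good and ergodic. In other words, for $\lambda$-almost every $y\in[0,1]$, for every measure-preserving system $(X,\mathcal{X},\mu,T)$ and every $f\in L^2(\mu)$, $$\lim_{N\to\infty}\frac1N\sum_{n=1}^N f\big(T^{a_n(y)}x\big)=\mathbb{E}(f\mid\mathcal{I}(T))(x)\quad\text{for }\mu\text{-almost every }x\in X$$ (the exceptional null set of $y$ does not depend on the system or on $f$).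
   Context: $\mathbb{N}=\{1,2,3,\dots\}$; $\lambda$ is Lebesgue measure on $[0,1]$; $\{x\}$ denotes the fractional part of the real number $x$. For $\delta\ge 0$, a sequence $(u_n)_{n\in\mathbb{N}}$ of positive real numbers is $\delta$-sublacunary if there is $c\in(0,1)$ such that $u_{n+1}/u_n\ge 1+cn^{-\delta}$ for every $n\in\mathbb{N}$. A measure-preserving system $(X,\mathcal{X},\mu,T)$ consists of a probability space $(X,\mathcal{X},\mu)$ and a measurable map $T:X\to X$ with $\mu(T^{-1}A)=\mu(A)$ for all $A\in\mathcal{X}$. $\mathcal{I}(T)=\{A\in\mathcal{X}:\ \mu(A\,\Delta\,T^{-1}A)=0\}$ is the $\sigma$-algebra of invariant sets, and $\mathbb{E}(f\mid\mathcal{I}(T))$ is the conditional expectation. A sequence of integers $(a_n)_{n\in\mathbb{N}}$ is pointwise universally $L^p$-good if for every measure-preserving system $(X,\mathcal{X},\mu,T)$ and every $f\in L^p(X,\mu)$ the limit $\lim_{N\to\infty}\frac1N\sum_{n=1}^N f(T^{a_n}x)$ exists for $\mu$-almost every $x\in X$; it is ergodic if the $L^2$-limit of these averages equals $\mathbb{E}(f\mid\mathcal{I}(T))$. An infinite set of positive integers is said to have one of these properties if its increasing enumeration does. *)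

(* Defs.v *)
From HB Require Import structures.
From mathcomp Require Export all_boot all_order all_algebra.
From mathcomp Require Export all_classical all_reals all_analysis.

Set Implicit Arguments.
Unset Strict Implicit.
Unset Printing Implicit Defensive.
Import Order.TTheory GRing.Theory Num.Theory.
Import numFieldNormedType.Exports.

Local Open Scope classical_set_scope.
Local Open Scope ring_scope.

(* Sequences indexed by {1, 2, 3, ...} are functions on [nat] whose value at 0
   is never used. *)

Definition frac_part (R : realType) (x : R) : R := x - (Num.floor x)%:~R.

Definition sublacunary (R : realType) (delta : R) (u : nat -> R) : Prop :=
  (forall n, (0 < n)%N -> 0 < u n) /\
  exists c : R, [/\ 0 < c, c < 1 &
    forall n, (0 < n)%N -> 1 + c * n%:R `^ (- delta) <= u n.+1 / u n].

(* Empty and degenerate intervals are allowed, hence "at most l". *)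
Definition union_of_intervals (R : realType) (l : nat) (A : set R) : Prop :=
  exists J : nat -> interval R, A = \bigcup_(k < l) [set` J k].

Definition measure_preserving (R : realType) (d : measure_display)
    (X : measurableType d) (mu : probability X R) (T : X -> X) : Prop :=
  measurable_fun setT T /\
  forall A, measurable A -> mu (T @^-1` A) = mu A.

Definition invariant_sets (R : realType) (d : measure_display)
    (X : measurableType d) (mu : probability X R) (T : X -> X) : set (set X) :=
  [set A | measurable A /\ mu (A `+` (T @^-1` A)) = 0%E].

(* [g] is a version of the conditional expectation E(f | G); two versions are
   equal mu-almost everywhere. *)
Definition is_cond_exp (R : realType) (d : measure_display)
    (X : measurableType d) (mu : probability X R) (G : set (set X))
    (f g : X -> R) : Prop :=
  [/\ forall B : set R, measurable B -> G (g @^-1` B),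
      mu.-integrable setT (EFin \o g) &
      forall A, G A ->
        (\int[mu]_(x in A) (g x)%:E = \int[mu]_(x in A) (f x)%:E)%E].

Definition ergodic_average (R : realType) (X : Type) (T : X -> X)
    (s : nat -> nat) (f : X -> R) (N : nat) (x : X) : R :=
  N%:R^-1 * \sum_(1 <= n < N.+1) f (iter (s n) T x).

(* [T] need not be invertible, so the exponents [s n] are natural numbers. *)
Definition pointwise_universally_good (R : realType) (p : \bar R)
    (s : nat -> nat) : Prop :=
  forall (d : measure_display) (X : measurableType d) (mu : probability X R)
    (T : X -> X), measure_preserving mu T ->
  forall f : X -> R, f \in Lfun mu p ->
  {ae mu, forall x, cvgn (fun N => ergodic_average T s f N x)}.

Definition ergodic_sequence (R : realType) (s : nat -> nat) : Prop :=
  forall (d : measure_display) (X : measurableType d) (mu : probability X R)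
    (T : X -> X), measure_preserving mu T ->
  forall f : X -> R, f \in Lfun mu 2%:E ->
  exists2 g : X -> R, is_cond_exp mu (invariant_sets mu T) f g &
    (Lnorm mu 2%:E (fun x => (ergodic_average T s f N x - g x)%:E)
       @[N --> \oo] --> 0%E).

Definition increasing_enumeration (A : set nat) (s : nat -> nat) : Prop :=
  (forall n, (0 < n)%N -> (s n < s n.+1)%N) /\
  s @` [set n | (0 < n)%N] = A.

Definition hitting_times (R : realType) (u : nat -> R) (I : nat -> set R)
    (y : R) : set nat :=
  [set n | (0 < n)%N /\ I n (frac_part (u n * y))].

(* Main.v *)
Require Import Defs.
From mathcomp Require Import measurable_realfun ring lra zify.
Import Order.TTheory GRing.Theory Num.Theory.
Import numFieldNormedType.Exports.
Local Open Scope classical_set_scope.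
Local Open Scope ring_scope.

(** The event that the fractional part of [u n * y] falls into [I n] has
    probability close to [n^(-a)]; let [dev n y] be its indicator minus
    [n^(-a)]. For a system [(X, mu, T)], the sum of [f (T^n x)] over the
    hitting times [n <= N] splits into the sum of [n^(-a) f (T^n x)] and the
    sum of [dev n y * f (T^n x)]. The weights [n^(-a)] decrease, so the
    first sum, divided by the sum of the weights, has the same limit as the
    plain ergodic averages ([weighted_cvg]), which converge by Birkhoff's
    theorem ([birkhoff]). What remains is to show that the second sum is
    negligible against the sum of the weights, which has order [N^(1 - a)],
    and to do so for a set of [y] that does not depend on the system.

    Separation of [y] from the system. The correlation of [f o T^i] and [f o
    T^j] depends only on the difference of [i] and [j], and is at most the
    squared norm of [f]. Hence the squared norm of the sum of the [dev n y *
    f o T^n] over [n <= N] is at most twice that of [f] times the sum over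
    the lags [h] of the moduli of the autocovariances of the single sequence
    [dev 1 y, dev 2 y, ...] ([int_weighted_sq]). If that sum over the lags,
    [autocov_sum N y], divided by [N^(2 - 2 a)], is summable along the times
    [N = (k + 1)^m], then the error terms tend to 0 almost everywhere along
    these times, in every system. The ratio of consecutive times tends to 1
    and sums of nonnegative terms are monotone, so the convergence extends
    to all [N] ([interpolate_cvg]).

    The estimate on [y]. Let [3 eps = 1 - 2 a - delta]. It suffices that
    [autocov_sum N] has mean at most [C N^(2 - 2 a - eps)]
    ([E_autocov_sum]). The source of cancellation is that [dev n] has mean
    zero on each of its periods, of length [1 / u n]: against a step
    function with few pieces it integrates to little ([Rintegral_mul_step]),
    and a product of [dev]s of lower frequencies is such a step function.
    Sublacunarity makes the ratio of two frequencies exceed [N^2] once the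
    indices, both below [N], differ by a multiple of [N^(delta + eps)]
    ([far_ratio]). For a longer lag, the second moment of the autocovariance
    is a double sum of four-point correlations, among which only the pairs
    of indices at distance at most that multiple matter: it is at most [C
    N^(1 + delta + eps - 2 a)]. The shorter lags are so few that a trivial
    bound serves for them.

    Identification of the limit. Almost everywhere convergence implies
    convergence in mean square ([avg_cvg_L2]), and integrals over invariant
    sets are preserved by ergodic averages; so the limit of the plain
    averages, which is also the limit along the hitting times, is the
    conditional expectation ([is_cond_exp_birkhoff]). *)

Set Implicit Arguments.
Unset Strict Implicit.
Unset Printing Implicit Defensive.

(** * Oscillation of the dilated indicator *)

Lemma measurable_floorR (R : realType) (D : set R) :
  measurable_fun D (fun x : R => (Num.floor x)%:~R : R).
Proof.
apply: (measurable_funS measurableT) => //.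
apply: nondecreasing_measurable => // x y xy.
by rewrite ler_int le_floor.
Qed.

(** Uniqueness of Lebesgue measure: the right-hand side is a measure in [A],
    with the correct values on intervals. *)
Lemma lebesgue_measure_affine (R : realType) (u c : R) (A : set R) :
  0 < u -> measurable A ->
  (lebesgue_measure A = u%:E * lebesgue_measure ((fun y => (u * y + c)%R) @^-1` A))%E.
Proof.
move=> u0 mA.
have mphi : measurable_fun setT (fun y : R => u * y + c).
  by apply: measurable_funD => //; exact: measurable_funM.
pose phi (y : measurableTypeR R) : measurableTypeR R := u * y + c.
have {}mphi : measurable_fun setT phi by [].
pose m : {measure set (measurableTypeR R) -> \bar R} :=
  measure_function_mscale__canonical__measure_function_Measure (NngNum (ltW u0))
   (measure_function_pushforward__canonical__measure_function_Measure (@lebesgue_measure R) mphi).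
rewrite (@lebesgue_measure_unique R m) // => X [[a b] _ <-] /=.
rewrite lebesgue_measure_itv /m /mscale /pushforward /=.
rewrite /pushforward (_ : phi @^-1` _ = `](a - c) / u, (b - c) / u]%classic); last first.
  by apply/seteqP; split => x /=; rewrite !in_itv /= ltr_pdivrMr // ler_pdivlMr // ltrBlDr lerBrDr mulrC //.
rewrite lebesgue_measure_itv /= !lte_fin ltr_pM2r ?invr_gt0 // ltrD2r.
case: ifP => ab; last by rewrite mule0.
rewrite -EFinM; congr (_%:E); field; exact: lt0r_neq0.
Qed.

(** A class of integrands stable under the ring operations and integrable on
    every bounded interval, so that linearity of the integral has no side
    conditions to carry. *)
Definition bmeas (R : realType) (f : R -> R) : Prop :=
  measurable_fun setT f /\ exists M : R, forall x, `|f x| <= M.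

Section bmeas.
Variable R : realType.
Implicit Types f g : R -> R.

Lemma bmeasD f g : bmeas f -> bmeas g -> bmeas (fun x => f x + g x).
Proof.
move=> [mf [M fM]] [mg [N gN]]; split; first exact: measurable_funD.
by exists (M + N) => x; rewrite (le_trans (ler_normD _ _)) // lerD.
Qed.

Lemma bmeasM f g : bmeas f -> bmeas g -> bmeas (fun x => f x * g x).
Proof.
move=> [mf [M fM]] [mg [N gN]]; split; first exact: measurable_funM.
by exists (M * N) => x; rewrite normrM ler_pM.
Qed.

Lemma bmeas_cst (c : R) : bmeas (fun=> c).
Proof. by split=> //; exists `|c|. Qed.

Lemma bmeasN f : bmeas f -> bmeas (fun x => - f x).
Proof.
move=> [mf [M fM]]; split; first exact: measurable_funN.
by exists M => x; rewrite normrN.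
Qed.

Lemma bmeasB f g : bmeas f -> bmeas g -> bmeas (fun x => f x - g x).
Proof. by move=> ? ?; apply: bmeasD => //; exact: bmeasN. Qed.

Lemma bmeas_norm f : bmeas f -> bmeas (fun x => `|f x|).
Proof.
move=> [mf [M fM]]; split; first exact: measurableT_comp.
by exists M => x; rewrite normr_id.
Qed.

Lemma bmeasX f n : bmeas f -> bmeas (fun x => f x ^+ n).
Proof.
move=> nf; elim: n => [|n ih].
  by under eq_fun do rewrite expr0; exact: bmeas_cst.
by under eq_fun do rewrite exprS; exact: bmeasM.
Qed.

Lemma bmeas_sum (J : Type) (s : seq J) (P : pred J) (F : J -> R -> R) :
  (forall j, bmeas (F j)) -> bmeas (fun x => \sum_(j <- s | P j) F j x).
Proof.
move=> nF; elim: s => [|j s ih].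
  by under eq_fun do rewrite big_nil; exact: bmeas_cst.
under eq_fun do rewrite big_cons.
by case: (P j) => //; exact: bmeasD.
Qed.

Lemma bmeas_integrable f (a b : R) (x y : bool) : bmeas f ->
  (@lebesgue_measure R).-integrable [set` Interval (BSide x a) (BSide y b)] (EFin \o f).
Proof.
move=> [mf [M fM]]; apply: measurable_bounded_integrable => //.
- by rewrite /= lebesgue_measure_itv /=; case: ifP => // _; rewrite ltey.
- exact: (measurable_funS measurableT).
- exists M; split; first exact: num_real.
  by move=> r /ltW Mr z _ /=; exact: le_trans (fM z) Mr.
Qed.

Local Notation I01 := (`[0, 1]%classic : set R).
Local Notation E f := (\int[lebesgue_measure]_(x in I01) f x).

Lemma Rint01D f g : bmeas f -> bmeas g -> E (fun x => f x + g x) = E f + E g.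
Proof. by move=> ? ?; rewrite RintegralD //; exact: bmeas_integrable. Qed.

Lemma Rint01Z f c : bmeas f -> E (fun x => c * f x) = c * E f.
Proof. by move=> ?; rewrite RintegralZl //; exact: bmeas_integrable. Qed.

Lemma Rint01_cst c : E (fun=> c) = c.
Proof.
by rewrite Rintegral_cst //= lebesgue_measure_itv /= lte_fin ltr01 -EFinB subr0 /= mulr1.
Qed.

Lemma le_Rint01 f g : bmeas f -> bmeas g -> (forall x, 0 <= x <= 1 -> f x <= g x) -> E f <= E g.
Proof.
move=> nf ng fg; apply: le_Rintegral => //; try exact: bmeas_integrable.
Qed.

Lemma Rint01_sum (J : Type) (s : seq J) (P : pred J) (F : J -> R -> R) :
  (forall j, bmeas (F j)) ->
  E (fun x => \sum_(j <- s | P j) F j x) = \sum_(j <- s | P j) E (F j).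
Proof.
move=> nF; elim: s => [|j s ih].
  under eq_Rintegral do rewrite big_nil.
  by rewrite big_nil; exact: Rint01_cst.
under eq_Rintegral do rewrite big_cons.
rewrite big_cons; case: (P j) => //.
by rewrite Rint01D ?ih //; exact: bmeas_sum.
Qed.

Lemma Rintegral_itv_split f (a b c : R) : bmeas f -> a <= b -> b <= c ->
  \int[lebesgue_measure]_(x in `[a, c[) f x =
  \int[lebesgue_measure]_(x in `[a, b[) f x + \int[lebesgue_measure]_(x in `[b, c[) f x.
Proof.
move=> nf ab bc.
rewrite -Rintegral_setU //.
- by rewrite -itv_bndbnd_setU // bnd_simp.
- by rewrite -itv_bndbnd_setU // ?bnd_simp //; exact: bmeas_integrable.
- apply/disj_setPS => y [/=]; rewrite 2!in_itv/= => /andP[_ yx] /andP[].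
  by rewrite leNgt yx.
Qed.

Lemma le_norm_Rintegral_itv f (a b M : R) : bmeas f -> a <= b ->
  (forall x, `|f x| <= M) -> `|\int[lebesgue_measure]_(x in `[a, b[) f x| <= M * (b - a).
Proof.
move=> nf ab fM.
apply: (le_trans (le_normr_Rintegral _ _)) => //; first exact: bmeas_integrable.
apply: (@le_trans _ _ (\int[lebesgue_measure]_(x in `[a, b[) M)).
  apply: le_Rintegral => //; apply: bmeas_integrable; [exact: bmeas_norm|exact: bmeas_cst].
rewrite Rintegral_cst //= lebesgue_measure_itv /= lte_fin.
case: ltP => //=; move: ab; rewrite le_eqVlt => /predU1P[->|]; first by rewrite subrr.
by move=> /lt_geF ->.
Qed.

End bmeas.

Section rotation.
Variable R : realType.
Variables (u : R) (A : set R).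
Hypotheses (u0 : 0 < u) (mA : measurable A) (A01 : A `<=` `[0, 1]).

Local Notation leb := (@lebesgue_measure R).

Definition hit (y : R) : R := \1_A (frac_part (u * y)).

Lemma bmeas_hit : bmeas hit.
Proof.
split; last first.
  by exists 1 => x; rewrite /hit indicE; case: (_ \in _); rewrite ?normr1 ?normr0.
apply: (@measurableT_comp _ _ _ _ _ _ (\1_A : R -> R) _ (fun y => frac_part (u * y))) => //.
have mu_ : measurable_fun setT (fun y : R => u * y) by exact: measurable_funM.
apply: measurable_funB => //.
apply: (@measurableT_comp _ _ _ _ _ _ (fun x : R => (Num.floor x)%:~R : R) _ ( *%R u)) => //.
exact: measurable_floorR.
Qed.

Definition centred_hit (y : R) := hit y - fine (leb A).

Lemma bmeas_centred_hit : bmeas centred_hit.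
Proof. by apply: bmeasB; [exact: bmeas_hit|exact: bmeas_cst]. Qed.

Lemma leb_A_le1 : (leb A <= 1)%E.
Proof.
have -> : (1%:E = leb `[0%R, 1%R]%classic)%E.
  by rewrite /= lebesgue_measure_itv /= lte_fin ltr01 -EFinB subr0.
by apply: le_measure => //; rewrite inE.
Qed.

Lemma fine_leb_A : 0 <= fine (leb A) <= 1.
Proof.
have A0 : (0 <= leb A)%E by exact: measure_ge0.
apply/andP; split; first exact: fine_ge0.
rewrite -lee_fin fineK ?leb_A_le1 // ge0_fin_numE //.
exact: le_lt_trans leb_A_le1 (ltey _).
Qed.

Lemma hit_ge0 y : 0 <= hit y. Proof. by rewrite /hit indicE. Qed.
Lemma hit_le1 y : hit y <= 1. Proof. by rewrite /hit indicE lern1 leq_b1. Qed.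

Lemma centred_hit_le1 y : `|centred_hit y| <= 1.
Proof.
have /andP[p0 p1] := fine_leb_A; have h0 := hit_ge0 y; have h1 := hit_le1 y.
by rewrite /centred_hit ler_norml; lra.
Qed.

Lemma frac_part_itv (k : nat) (y : R) : k%:R <= y < k.+1%:R -> frac_part y = y - k%:R.
Proof.
move=> ky; rewrite /frac_part (_ : Num.floor y = k) //.
by apply/floor_def; rewrite intrD -!pmulrn natr1.
Qed.

(** On this period the fractional part of [u * y] is [u * y - k], an affine
    map of the period onto the unit interval without its right end, where
    [A] has the measure that is subtracted. *)
Lemma Rintegral_centred_hit_period (k : nat) :
  \int[lebesgue_measure]_(y in `[k%:R / u, k.+1%:R / u[) centred_hit y = 0.
Proof.
have ku : k%:R / u <= k.+1%:R / u.
  by rewrite ler_pM2r ?invr_gt0 // ler_nat.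
have ku' : k%:R / u < k.+1%:R / u.
  by rewrite ltr_pM2r ?invr_gt0 // ltr_nat.
have E : lebesgue_measure (`[k%:R / u, k.+1%:R / u[%classic : set R) = (u^-1)%:E.
  by rewrite /= lebesgue_measure_itv /= lte_fin ku' -EFinB -mulrBl -natr1 addrC addKr mul1r.
rewrite /centred_hit RintegralB //; [|exact: (bmeas_integrable _ _ _ _ bmeas_hit)|exact: (bmeas_integrable _ _ _ _ (bmeas_cst _))].
rewrite Rintegral_cst //= E /=.
rewrite {1}/Rintegral.
have -> : (\int[lebesgue_measure]_(x in `[(k%:R / u)%R, (k.+1%:R / u)%R[) (hit x)%:E
  = leb ((fun y => (u * y + (- k%:R))%R) @^-1` (A `\ 1%R)))%E.
  under eq_integral => x xI.
    (* the fractional part never reaches 1, so the endpoint 1 has to be removed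
       from [A] *)
    have -> : hit x = \1_((fun y => u * y + (- k%:R)) @^-1` (A `\ 1)) x.
      move: xI; rewrite inE /= in_itv /= ler_pdivrMr // ltr_pdivlMr // mulrC => kx.
      rewrite /hit !indicE (frac_part_itv kx); congr ((_ : bool)%:R).
      apply/idP/idP; rewrite !inE /=; last by case.
      split=> // x1; move: kx; rewrite -natr1; lra.
    over.
  rewrite integral_indic //; last first.
    rewrite -[X in measurable X]setTI; apply: measurable_funD => //; last exact: measurableD.
    congr (leb _); apply/setIidl => x [/A01]/=; rewrite !in_itv /=.
  rewrite ler_pdivrMr // ltr_pdivlMr // mulrC -natr1 => /andP[x0 x1] /eqP xn1.
  apply/andP; split; first lra.
  rewrite lt_neqAle; apply/andP; split; last lra.
  by apply/eqP => x2; move/eqP: xn1; apply; rewrite x2 addrC addKr.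
have := @lebesgue_measure_affine R u (- k%:R) (A `\ 1) u0 (measurableD mA (measurable_set1 _)).
rewrite measureD //; last exact: le_lt_trans leb_A_le1 (ltey _).
rewrite [X in (_ - X)%E](_ : _ = 0)%E; last first.
  apply/eqP; rewrite eq_le measure_ge0 andbT -(lebesgue_measure_set1 (1:R)).
  by apply: le_measure; rewrite ?inE //; exact: measurableI.
rewrite sube0 => ->.
have uu : u != 0 by exact: lt0r_neq0.
move: (measure_ge0 leb ((fun y => u * y + (- k%:R)) @^-1` (A `\ 1))) => /=.
case: (leb _) => [r||] // _ /=; last by rewrite mulry gtr0_sg // mul1e /= mul0r subrr.
by rewrite [u * r]mulrC mulfK // subrr.
Qed.

Lemma Rintegral_centred_hit_periods (m : nat) :
  \int[lebesgue_measure]_(y in `[0, m%:R / u[) centred_hit y = 0.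
Proof.
elim: m => [|m ih]; first by rewrite mul0r set_itvco0 Rintegral_set0.
rewrite (@Rintegral_itv_split _ centred_hit 0 (m%:R / u)) //.
- by rewrite ih Rintegral_centred_hit_period addr0.
- exact: bmeas_centred_hit.
- by rewrite divr_ge0 // ltW.
- by rewrite ler_pM2r ?invr_gt0 // ler_nat.
Qed.

(** The complete periods contribute 0, and what is left of the interval is
    shorter than a period. *)
Lemma Rintegral_centred_hit_from0 (b : R) : 0 <= b ->
  `|\int[lebesgue_measure]_(y in `[0, b[) centred_hit y| <= u^-1.
Proof.
move=> b0; pose m := Num.truncn (u * b).
have /andP[m1 m2] : m%:R <= u * b < m.+1%:R.
  by apply: truncn_itv; rewrite mulr_ge0 // ltW.
have mb : m%:R / u <= b by rewrite ler_pdivrMr // mulrC.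
rewrite (@Rintegral_itv_split _ centred_hit 0 (m%:R / u)) //; last 2 first.
- exact: bmeas_centred_hit.
- by rewrite divr_ge0 // ltW.
rewrite Rintegral_centred_hit_periods add0r.
apply: (le_trans (le_norm_Rintegral_itv bmeas_centred_hit mb centred_hit_le1)).
rewrite mul1r lerBlDr addrC -[X in _ <= _ + X]mul1r -mulrDl natr1 ler_pdivlMr // mulrC.
exact: ltW.
Qed.

Lemma Rintegral_centred_hit_itv (a b : R) : 0 <= a -> a <= b ->
  `|\int[lebesgue_measure]_(y in `[a, b[) centred_hit y| <= 2 / u.
Proof.
move=> a0 ab.
have := @Rintegral_itv_split _ centred_hit 0 a b bmeas_centred_hit a0 ab.
have := Rintegral_centred_hit_from0 a0; have := Rintegral_centred_hit_from0 (le_trans a0 ab).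
rewrite !ler_norml => /andP[? ?] /andP[? ?] E.
by apply/andP; split; lra.
Qed.

End rotation.

(** * Integrals against step functions *)

Section steps.
Variable R : realType.
Implicit Types (s : seq R) (f g : R -> R).

(** Constancy between breakpoints, rather than an expansion into indicators,
    because a product is then handled by concatenating the lists of
    breakpoints. The closed segment from [x] to [y] has to avoid the
    breakpoints, so the values at the breakpoints are free and endpoints of
    intervals need not be told open or closed. *)
Definition step_on s g := forall x y : R, 0 <= x -> x <= y -> y <= 1 ->
  (forall b, b \in s -> ~~ (x <= b <= y)) -> g x = g y.

Lemma step_onM s s' f g : step_on s f -> step_on s' g ->
  step_on (s ++ s') (fun x => f x * g x).
Proof.
move=> sf sg x y x0 xy y1 h; congr (_ * _); [apply: sf => //|apply: sg => //];
  by move=> b bs; apply: h; rewrite mem_cat bs ?orbT.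
Qed.

Lemma step_onB s g (c : R) : step_on s g -> step_on s (fun x => g x - c).
Proof. by move=> sg x y x0 xy y1 h; rewrite (sg x y). Qed.

Lemma Rintegral_itvco_oo f (a b : R) : bmeas f ->
  \int[lebesgue_measure]_(x in `[a, b[) f x = \int[lebesgue_measure]_(x in `]a, b[) f x.
Proof. by move=> nf; rewrite -Rintegral_itv_obnd_cbnd //; exact: bmeas_integrable. Qed.

(** Cutting at the breakpoints leaves at most [size s + 1] intervals inside
    which [g] is a constant of modulus at most 1, and each of them
    contributes at most [C]. The induction is on the number of breakpoints
    inside the interval and cuts at any one of them, so the list may be
    unsorted and have repetitions. *)
Lemma Rintegral_mul_step (f g : R -> R) (s : seq R) (C : R) :
  bmeas f -> bmeas g -> (forall x, `|g x| <= 1) ->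
  (forall a b, 0 <= a -> a <= b ->
     `|\int[lebesgue_measure]_(y in `[a, b[) f y| <= C) ->
  step_on s g ->
  `|\int[lebesgue_measure]_(y in `[0, 1]) (f y * g y)| <= (size s).+1%:R * C.
Proof.
move=> nf ng g1 fC sg.
have C0 : 0 <= C by apply: le_trans (fC 0 0 _ _).
have nfg := bmeasM nf ng.
pose ct (a b : R) := count (fun x : R => (a < x < b)%R) s.
suff H : forall (n : nat) (a b : R), 0 <= a -> a <= b -> b <= 1 -> (ct a b < n)%N ->
   `|\int[lebesgue_measure]_(y in `[a, b[) (f y * g y)| <= (ct a b).+1%:R * C.
  rewrite -Rintegral_itv_bndo_bndc; last exact: (bmeas_integrable _ _ _ _ nfg).
  apply: (le_trans (H (ct 0 1).+1 0 1 _ _ _ _)) => //.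
  by rewrite ler_wpM2r // ler_nat ltnS count_size.
elim=> // n ih a b a0 ab b1 cs.
have [ct0|ctn0] := eqVneq (ct a b) 0%N.
  rewrite ct0 mul1r; move: ab; rewrite le_eqVlt => /predU1P[<-|ab].
    by rewrite set_itvco0 Rintegral_set0 normr0.
  rewrite Rintegral_itvco_oo //.
  pose m := (a + b) / 2.
  have gm x : a < x < b -> g x = g m.
    move=> /andP[ax xb]; have am : a < m by rewrite /m; lra.
    have mb : m < b by rewrite /m; lra.
    have nos c : c \in s -> ~~ (a < c < b).
      move=> cis; apply/negP => ch; move/eqP: ct0; rewrite -leqn0 leqNgt -has_count => /hasP; apply.
      by exists c.
    have [xm|mx] := leP x m.
      apply: sg; [lra|lra|lra|] => c /nos; apply: contra => /andP[? ?].
      by apply/andP; split; lra.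
    apply/esym/sg; [lra|lra|lra|] => c /nos; apply: contra => /andP[? ?].
    by apply/andP; split; lra.
  have -> : \int[lebesgue_measure]_(x in `]a, b[) (f x * g x) =
            \int[lebesgue_measure]_(x in `]a, b[) (g m * f x).
    by apply: eq_Rintegral => x; rewrite inE /= in_itv /= => xab; rewrite gm // mulrC.
  rewrite RintegralZl //; last exact: bmeas_integrable.
  rewrite normrM -Rintegral_itvco_oo //.
  by rewrite -[leRHS]mul1r ler_pM // fC // ltW.
have : has (fun x : R => a < x < b) s by rewrite has_count lt0n.
move=> /hasP[c cis /andP[ac cb]].
(* the cut point itself lies inside neither half *)
have split_count : (ct a c + ct c b + 1 <= ct a b)%N.
  have : (ct a c + ct c b + count_mem c s <= ct a b)%N.
    rewrite /ct; elim: (s) => //= x s' ihs.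
    have : ((a < x < c)%R + (c < x < b)%R + (x == c) <= (a < x < b)%R)%N.
      case: (ltgtP x c) => [xc|xc|->]; rewrite ?andbF ?andbT /= ?addn0 ?add0n.
      - by rewrite (lt_trans xc cb) andbT.
      - by rewrite (lt_trans ac xc).
      - by rewrite ac cb.
    by move=> H; rewrite (leq_trans _ (leq_add H ihs)) //; clear; lia.
  have : (0 < count_mem c s)%N by rewrite -has_count has_pred1.
  by move=> c1; apply: leq_trans; rewrite leq_add2l.
rewrite (@Rintegral_itv_split _ _ a c b nfg (ltW ac) (ltW cb)).
apply: (le_trans (ler_normD _ _)).
have h1 : `|\int[lebesgue_measure]_(y in `[a, c[) (f y * g y)| <= (ct a c).+1%:R * C.
  apply: ih => //; [exact: ltW|exact: le_trans (ltW cb) b1|move: split_count cs; clear; lia].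
have h2 : `|\int[lebesgue_measure]_(y in `[c, b[) (f y * g y)| <= (ct c b).+1%:R * C.
  apply: ih => //; [exact: le_trans (ltW ac)|exact: ltW|move: split_count cs; clear; lia].
apply: (le_trans (lerD h1 h2)).
rewrite -mulrDl -natrD ler_wpM2r // ler_nat; move: split_count; clear; lia.
Qed.

Definition bound_pts (b : itv_bound R) : seq R := if b is BSide _ x then [:: x] else [::].
Definition itv_pts (J : interval R) : seq R := let: Interval a b := J in bound_pts a ++ bound_pts b.

Lemma size_itv_pts J : (size (itv_pts J) <= 2)%N.
Proof. by case: J => [[? ?|?] [? ?|?]]. Qed.

Lemma itv_pts_const (J : interval R) (x y : R) : x <= y ->
  (forall b, b \in itv_pts J -> ~~ (x <= b <= y)) -> (x \in J) = (y \in J).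
Proof.
case: J => a b xy h; rewrite !itv_boundlr.
have hl (c : itv_bound R) : {subset bound_pts c <= itv_pts (Interval a b)} ->
   ((c <= BLeft x) = (c <= BLeft y))%O /\ ((BRight x <= c) = (BRight y <= c))%O.
  case: c => [bb c|bb] // sub.
  have {sub}: ~~ (x <= c <= y) by apply: h; apply: sub; rewrite inE.
  rewrite negb_and -!ltNge => cc.
  case: bb; rewrite !bnd_simp; split; apply/idP/idP; move: cc => /orP[] ? ?; lra.
have [-> _] := hl a (fun z za => mem_subseq (prefix_subseq _ _) za).
by have [_ ->] := hl b (fun z zb => mem_subseq (suffix_subseq _ _) zb).
Qed.

Definition union_pts (J : nat -> interval R) (l : nat) : seq R :=
  flatten [seq itv_pts (J k) | k <- iota 0 l].

(** The points that dilation by [u] sends to [k + x], with [x] in the list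
    [e] or [x = 0], and with [k] among the integers that [u * y] can reach
    for [y] at most 1; the extra point 0 accounts for the jumps of the
    fractional part. *)
Definition rot_pts (u : R) (e : seq R) : seq R :=
  [seq (k%:R + x) / u | k <- iota 0 (Num.truncn u).+1, x <- 0 :: e].

Lemma size_union_pts J l : (size (union_pts J l) <= 2 * l)%N.
Proof.
rewrite /union_pts size_flatten /shape -map_comp.
suff H m : (sumn (map (size \o (fun k => itv_pts (J k))) (iota m l)) <= 2 * l)%N by exact: H.
elim: l m => // l ih m /=.
by have := ih m.+1; have := size_itv_pts (J m); lia.
Qed.

Lemma size_rot_pts u e : size (rot_pts u e) = ((Num.truncn u).+1 * (size e).+1)%N.
Proof. by rewrite size_allpairs size_iota. Qed.

(** Away from these points, [u * y] stays between two consecutive integers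
    and its fractional part crosses no endpoint of the intervals. *)
Lemma step_on_hit (u : R) (A : set R) (J : nat -> interval R) (l : nat) : 0 < u ->
  A = \bigcup_(k < l) [set` J k] ->
  step_on (rot_pts u (union_pts J l)) (hit u A).
Proof.
move=> u0 AE x y x0 xy y1 h.
have ux0 : 0 <= u * x by rewrite mulr_ge0 // ltW.
have uxy : u * x <= u * y by rewrite ler_pM2l.
have uyu : u * y <= u by rewrite ler_piMr // ltW.
(* the integer part at the right end; as no integer is crossed, it is also
   the integer part at [x] *)
pose k := Num.truncn (u * y).
have /andP[k1 k2] : k%:R <= u * y < k.+1%:R by apply: truncn_itv; rewrite (le_trans ux0).
have ku : (k < (Num.truncn u).+1)%N by rewrite ltnS; apply: le_truncn.
have hk e : e \in 0 :: union_pts J l -> ~~ (x <= (k%:R + e) / u <= y).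
  by move=> he; apply: h; apply/allpairsP; exists (k, e); rewrite mem_iota.
have kx : k%:R <= u * x.
  rewrite leNgt; apply/negP => xk; move/negP: (hk 0 (mem_head _ _)); apply.
  rewrite addr0 ler_pdivlMr // ler_pdivrMr //; apply/andP; split; lra.
have fx : frac_part (u * x) = u * x - k%:R by apply: frac_part_itv; apply/andP; split => //; lra.
have fy : frac_part (u * y) = u * y - k%:R by apply: frac_part_itv; apply/andP; split.
rewrite /hit !indicE fx fy; congr ((_ : bool)%:R).
have key i : (i < l)%N -> (u * x - k%:R \in J i) = (u * y - k%:R \in J i).
  move=> il; apply: itv_pts_const; first lra.
  move=> e ei; have : e \in 0 :: union_pts J l.
    rewrite inE; apply/orP; right; apply/flatten_mapP; exists i => //.
    by rewrite mem_iota.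
  move=> /hk; apply: contra => /andP[e1 e2].
  by rewrite ler_pdivlMr // ler_pdivrMr //; apply/andP; split; lra.
apply/idP/idP; rewrite !inE AE => -[i /= il iJ]; exists i => //=.
- by rewrite -key.
- by rewrite key.
Qed.
End steps.

(** * Sums of powers *)

Section powers.
Variable R : realType.

(** Concavity of the power, in the form of Young's inequality for [x `^ t]
    and 1 with exponents [t^-1] and [(1 - t)^-1]. *)
Lemma powR_le_tangent (x t : R) : 0 <= x -> 0 < t < 1 -> x `^ t <= 1 + t * (x - 1).
Proof.
move=> x0 /andP[t0 t1].
have s0 : 0 < 1 - t by rewrite subr_gt0.
have := @conjugate_powR R (x `^ t) 1 t^-1 (1 - t)^-1 (powR_ge0 _ _) ler01.
rewrite !invr_gt0 !invrK t0 s0 addrC subrK mulr1 powR1 -powRrM mulfV ?gt_eqF //.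
by rewrite powRr1 // => /(_ isT isT erefl); lra.
Qed.

(** By the tangent bound, [n `^ (1 - s)] grows by at least [(1 - s) * n `^
    (- s)] from [n - 1] to [n], so the sum telescopes. *)
Lemma sum_powR_le (s : R) (N : nat) : 0 < s < 1 ->
  \sum_(i < N) i.+1%:R `^ (- s) <= N%:R `^ (1 - s) / (1 - s).
Proof.
move=> /andP[s0 s1]; have t0 : 0 < 1 - s by rewrite subr_gt0.
elim: N => [|N ih].
  by rewrite big_ord0 divr_ge0 ?powR_ge0 // ltW.
rewrite big_ord_recr /=.
set n1 : R := N.+1%:R; have n0 : 0 < n1 by rewrite ltr0n.
have key : N%:R `^ (1 - s) <= n1 `^ (1 - s) - (1 - s) * n1 `^ (- s).
  have -> : N%:R `^ (1 - s) = n1 `^ (1 - s) * (N%:R / n1) `^ (1 - s).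
    by rewrite -powRM ?divr_ge0 // ?ltW // mulrCA mulfV ?gt_eqF // mulr1.
  have x0 : 0 <= N%:R / n1 by rewrite divr_ge0 // ltW.
  have tt : 0 < 1 - s < 1 by lra.
  have := powR_le_tangent x0 tt.
  have -> : 1 + (1 - s) * (N%:R / n1 - 1) = 1 - (1 - s) / n1.
    have -> : N%:R = n1 - 1 by rewrite /n1 -natr1 addrK.
    by field; rewrite gt_eqF.
  move=> /(ler_wpM2l (powR_ge0 n1 (1 - s))) /le_trans; apply.
  rewrite mulrBr mulr1 lerB // mulrCA ler_wpM2l ?(ltW t0) //.
  by rewrite powRD ?(gt_eqF n0) ?implybT // powRr1 ?(ltW n0) // mulrAC mulfV ?gt_eqF // mul1r.
apply: (le_trans (lerD ih (lexx _))).
rewrite -[X in _ + X](mulfK (lt0r_neq0 t0)) -mulrDl ler_wpM2r ?invr_ge0 ?(ltW t0) //.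
by move: key; rewrite -/n1 (mulrC (n1 `^ _)); lra.
Qed.

Lemma bernoulli_le (x : R) (n : nat) : 0 <= x -> 1 + n%:R * x <= (1 + x) ^+ n.
Proof.
move=> x0; elim: n => [|n ih]; first by rewrite mul0r addr0 expr0.
have nx : 0 <= n%:R * x by rewrite mulr_ge0.
rewrite exprS; apply: (@le_trans _ _ ((1 + x) * (1 + n%:R * x))).
  by rewrite -natr1; nra.
by rewrite ler_wpM2l // addr_ge0.
Qed.

End powers.

(** * Mean autocovariances of the hits *)

Section correlations.
Variables (R : realType) (a delta c : R) (u : nat -> R) (A : nat -> set R).
Variables (J : nat -> nat -> interval R) (l : nat).
Hypotheses (a_gt0 : 0 < a) (delta_ge0 : 0 <= delta) (a_delta : 2 * a + delta < 1).
Hypotheses (u_gt0 : forall i, 0 < u i) (c_gt0 : 0 < c) (c_lt1 : c < 1).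
Hypothesis u_step : forall i, 1 + c * i.+1%:R `^ (- delta) <= u i.+1 / u i.
Hypothesis A_itv : forall i, A i = \bigcup_(k < l) [set` J i k].
Hypothesis A_sub : forall i, A i `<=` `[0, 1].
Hypothesis A_meas : forall i, lebesgue_measure (A i) = (i.+1%:R `^ (- a))%:E.

Local Notation E f := (\int[lebesgue_measure]_(x in `[0, 1]) f x).

(** Index [i] stands for the rank [n = i + 1]. *)
Definition density (i : nat) : R := i.+1%:R `^ (- a).
Definition hit_at (i : nat) : R -> R := hit (u i) (A i).
Definition dev_at (i : nat) (y : R) : R := hit_at i y - density i.

Lemma measurable_target i : measurable (A i).
Proof. by rewrite A_itv; apply: bigcup_measurable => k _; exact: measurable_itv. Qed.

Lemma dev_atE i : dev_at i = centred_hit (u i) (A i).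
Proof. by apply/funext => y; rewrite /dev_at /centred_hit A_meas. Qed.

Lemma bmeas_hit_at i : bmeas (hit_at i). Proof. by apply: bmeas_hit; exact: measurable_target. Qed.
Lemma bmeas_dev_at i : bmeas (dev_at i). Proof. by rewrite dev_atE; apply: bmeas_centred_hit; exact: measurable_target. Qed.
Lemma dev_at_le1 i y : `|dev_at i y| <= 1.
Proof. by rewrite dev_atE; apply: centred_hit_le1; [exact: measurable_target|exact: A_sub]. Qed.
Lemma hit_at_ge0 i y : 0 <= hit_at i y. Proof. exact: hit_ge0. Qed.
Lemma hit_at_le1 i y : hit_at i y <= 1. Proof. exact: hit_le1. Qed.
Lemma density_gt0 i : 0 < density i. Proof. by rewrite powR_gt0. Qed.

Lemma natS_ge1 (i : nat) : 1 <= i.+1%:R :> R. Proof. by rewrite ler1n. Qed.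

Lemma density_le i j : (i <= j)%N -> density j <= density i.
Proof.
move=> ij; rewrite /density !powRN lef_pV2 ?posrE ?powR_gt0 //.
by rewrite ge0_ler_powR ?nnegrE // ?ler_nat // ltW.
Qed.

Lemma density_le1 i : density i <= 1.
Proof. by have := density_le (leq0n i); rewrite {2}/density powR1. Qed.

Lemma norm_dev_at_le i y : `|dev_at i y| <= hit_at i y + density i.
Proof.
have := hit_at_ge0 i y; have := density_gt0 i; rewrite /dev_at => ? ?.
by rewrite ler_norml; apply/andP; split; lra.
Qed.

Definition breakpoints (i : nat) : seq R := rot_pts (u i) (union_pts (J i) l).

Lemma step_hit_at i : step_on (breakpoints i) (hit_at i).
Proof. exact: step_on_hit. Qed.

Lemma step_dev_at i : step_on (breakpoints i) (dev_at i).
Proof. exact/step_onB/step_hit_at. Qed.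

Lemma u_mono i j : (i <= j)%N -> u i <= u j.
Proof.
elim: j => [|j ih]; first by rewrite leqn0 => /eqP ->.
rewrite leq_eqVlt => /predU1P[->//|/ih{}ih]; apply: (le_trans ih).
have := u_step j; rewrite ler_pdivlMr // => h.
apply: le_trans h; rewrite -[leLHS]mul1r ler_wpM2r // ?ltW //.
by rewrite ltrDl mulr_gt0 // powR_gt0.
Qed.

(** There are at most [(u i + 1) * (2 * l + 1)] breakpoints; since [u 0 <= u
    i], additive constants are at most [(u 0)^-1 * u i] and can be absorbed
    into a multiple of [u i]. *)
Definition pts_rate : R := (1 + (u 0)^-1) * (2 * l).+1%:R + (u 0)^-1.

Lemma pts_rate_gt0 : 0 < pts_rate.
Proof.
by rewrite /pts_rate addr_gt0 ?invr_gt0 // mulr_gt0 // addr_gt0 ?invr_gt0.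
Qed.

Lemma size_breakpoints i : (size (breakpoints i)).+1%:R <= pts_rate * u i.
Proof.
have ui : 1 <= (u 0)^-1 * u i by rewrite mulrC ler_pdivlMr // mul1r u_mono.
rewrite -natr1 /pts_rate mulrDl lerD // size_rot_pts natrM.
rewrite mulrAC ler_pM // ?ler_nat ?ltnS ?size_union_pts //.
rewrite -natr1 mulrDl mul1r lerD //.
have /andP[] := @truncn_itv R (u i) (ltW (u_gt0 i)); by [].
Qed.

(** On each piece where [g] is constant, the oscillations of [dev_at i]
    cancel but for the incomplete periods at the two ends. *)
Lemma E_dev_at_mul_step i (g : R -> R) (s : seq R) : bmeas g -> (forall x, `|g x| <= 1) ->
  step_on s g -> `|E (fun y => dev_at i y * g y)| <= (size s).+1%:R * (2 / u i).
Proof.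
move=> ng g1 sg; apply: Rintegral_mul_step => //; first exact: bmeas_dev_at.
by move=> x y x0 xy; rewrite dev_atE; apply: Rintegral_centred_hit_itv => //; exact: measurable_target.
Qed.

Lemma E_hit_at_le i : E (hit_at i) <= density i + 2 / u i.
Proof.
have := @E_dev_at_mul_step i (fun=> 1) [::] (bmeas_cst 1).
rewrite normr1 mul1r => /(_ (fun=> lexx _)).
rewrite (_ : (fun y => dev_at i y * 1) = (fun y => hit_at i y + (- density i))); last first.
  by apply/funext => y; rewrite mulr1.
rewrite Rint01D; [|exact: bmeas_hit_at|exact: bmeas_cst]; rewrite Rint01_cst => /(_ _)/ler_normlW.
by rewrite lerBlDr addrC; apply => x y.
Qed.

Lemma E_hit_at2_le i j : E (fun y => hit_at i y * hit_at j y) <= pts_rate * u i * (2 / u j) + density j * E (hit_at i).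
Proof.
rewrite (_ : (fun y => _) = (fun y => dev_at j y * hit_at i y + density j * hit_at i y)); last first.
  by apply/funext => y; rewrite /dev_at; ring.
have nwb : bmeas (fun y => dev_at j y * hit_at i y) by apply: bmeasM; [exact: bmeas_dev_at|exact: bmeas_hit_at].
have npb : bmeas (fun y => density j * hit_at i y) by apply: bmeasM; [exact: bmeas_cst|exact: bmeas_hit_at].
rewrite Rint01D // Rint01Z ?lerD2r; last exact: bmeas_hit_at.
have b1 y : `|hit_at i y| <= 1 by rewrite ger0_norm ?hit_at_ge0 ?hit_at_le1.
apply: (le_trans (ler_normlW (E_dev_at_mul_step j (bmeas_hit_at i) b1 (@step_hit_at i)))).
by rewrite ler_wpM2r ?size_breakpoints // divr_ge0 // ltW.
Qed.

(** The factor [dev_at j], meant to be the one of largest frequency, is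
    integrated against the product of the others, a step function with [O(u
    m)] pieces. *)
Lemma E_dev_at4_le i1 i2 i3 m j : (i1 <= m)%N -> (i2 <= m)%N -> (i3 <= m)%N ->
  `|E (fun y => dev_at j y * (dev_at i1 y * dev_at i2 y * dev_at i3 y))| <= 3 * pts_rate * u m * (2 / u j).
Proof.
move=> h1 h2 h3.
have nn : bmeas (fun y => dev_at i1 y * dev_at i2 y * dev_at i3 y).
  by do 2 (apply: bmeasM; last exact: bmeas_dev_at); exact: bmeas_dev_at.
have n1 y : `|dev_at i1 y * dev_at i2 y * dev_at i3 y| <= 1.
  by rewrite !normrM !mulr_ile1 ?dev_at_le1 // mulr_ge0.
have st := step_onM (step_onM (@step_dev_at i1) (@step_dev_at i2)) (@step_dev_at i3).
apply: (le_trans (E_dev_at_mul_step j nn n1 st)).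
rewrite ler_wpM2r ?divr_ge0 // ?(ltW (u_gt0 _)) //.
rewrite (size_cat (breakpoints i1 ++ breakpoints i2)) (size_cat (breakpoints i1)).
have L k : (k <= m)%N -> (size (breakpoints k)).+1%:R <= pts_rate * u m.
  by move=> km; rewrite (le_trans (size_breakpoints k)) // ler_wpM2l ?u_mono // ltW // pts_rate_gt0.
apply: (@le_trans _ _ ((size (breakpoints i1)).+1%:R + (size (breakpoints i2)).+1%:R + (size (breakpoints i3)).+1%:R)).
  by rewrite -!natrD ler_nat; lia.
by have := L _ h1; have := L _ h2; have := L _ h3; lra.
Qed.

(** Sublacunarity forces [u i] to grow at least like [i^(1 - delta)], and [1
    - delta > 2 * a]. The error [2 / u i] in the mean of a hit is therefore
    negligible even against the square of its density. *)
Lemma inv_u_le : exists C : R, 0 < C /\ forall i, 2 / u i <= C * i.+1%:R `^ (- (2 * a)).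
Proof.
have d1 : 0 < 1 - delta by move: a_delta a_gt0; lra.
have H i : c * u 0 * i.+1%:R `^ (1 - delta) <= u i.
  (* growth in additive form: each step up to [i] gains at least [u 0] times
     the smallest of the rates met *)
  have H1 k : (k <= i)%N -> u 0 * (1 + k%:R * (c * i.+1%:R `^ (- delta))) <= u k.
    elim: k => [|k ih] ki; first by rewrite mul0r addr0 mulr1.
    have := u_step k; rewrite ler_pdivlMr // => h; apply: le_trans h.
    have {}ih := ih (ltnW ki).
    have dk : i.+1%:R `^ (- delta) <= k.+1%:R `^ (- delta) :> R.
      by rewrite !powRN lef_pV2 ?posrE ?powR_gt0 // ge0_ler_powR ?nnegrE // ler_nat ltnS ltnW.
    have uk := u_mono (leq0n k).
    have cd : 0 < c * i.+1%:R `^ (- delta) by rewrite mulr_gt0 // powR_gt0.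
    rewrite mulrDl mul1r -natr1.
    apply: (@le_trans _ _ (u k + c * i.+1%:R `^ (- delta) * u 0)).
      by move: ih; rewrite !mulrDr; lra.
    rewrite lerD2l; apply: ler_pM => //; [exact: ltW|exact: ltW|].
    by rewrite natr1 ler_wpM2l // ltW.
  apply: le_trans (H1 i (leqnn _)).
  rewrite (mulrC c) -mulrA ler_wpM2l ?(ltW (u_gt0 _)) //.
  rewrite powRD ?gt_eqF ?implybT // powRr1 //.
  have : c * i.+1%:R `^ (- delta) <= 1.
    rewrite mulr_ile1 ?powR_ge0 ?(ltW c_gt0) ?(ltW c_lt1) // powRN invf_le1 ?powR_gt0 //.
    by apply: (@le_trans _ _ (i.+1%:R `^ 0)); [rewrite powRr0|apply: ler_powR; rewrite ?natS_ge1].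
  by rewrite -natr1; lra.
exists (2 / (c * u 0)); split=> [|i]; first by rewrite divr_gt0 // mulr_gt0.
rewrite -mulrA ler_wpM2l // powRN -invfM lef_pV2 ?posrE ?mulr_gt0 ?powR_gt0 //.
apply: le_trans (H i); rewrite ler_wpM2l ?mulr_ge0 ?(ltW c_gt0) ?(ltW (u_gt0 _)) //.
by apply: ler_powR; [exact: natS_ge1|move: a_delta; lra].
Qed.

Lemma u_ratio (N i k : nat) : (i + k < N)%N ->
  (1 + c * N%:R `^ (- delta)) ^+ k * u i <= u (i + k).
Proof.
elim: k => [|k ih] ikN; first by rewrite expr0 mul1r addn0.
have {}ih : (1 + c * N%:R `^ (- delta)) ^+ k * u i <= u (i + k) by apply: ih; lia.
rewrite addnS; have := u_step (i + k); rewrite ler_pdivlMr // => h; apply: le_trans h.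
rewrite exprS -mulrA; apply: ler_pM => //.
- by rewrite addr_ge0 // mulr_ge0 ?powR_ge0 // ltW.
- by rewrite mulr_ge0 ?exprn_ge0 ?addr_ge0 ?mulr_ge0 ?powR_ge0 ?ltW.
rewrite lerD2l ler_wpM2l ?(ltW c_gt0) // !powRN lef_pV2 ?posrE ?powR_gt0 // ?ltr0n; last by lia.
by rewrite ge0_ler_powR ?nnegrE // ler_nat; lia.
Qed.

Section variance.
(** The choice of one third of the room in the exponents makes the
    contribution of the long lags in [E_autocov_sum] a multiple of [N `^ (2
    - 2 * a - eps)]. *)
Let eps : R := (1 - 2 * a - delta) / 3.

Lemma eps_gt0 : 0 < eps.
Proof. by rewrite /eps divr_gt0 //; move: a_delta; lra. Qed.

Definition gap (N : nat) : nat := (Num.truncn (N%:R `^ (delta + eps) : R)).+1.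

Lemma gap_ge N : N%:R `^ (delta + eps) <= (gap N)%:R.
Proof. by rewrite ltW // truncnS_gt. Qed.

Lemma gap_le N : (0 < N)%N -> (gap N)%:R <= 2 * N%:R `^ (delta + eps).
Proof.
move=> N0; rewrite /gap -natr1 mulr_natl mulr2n lerD //.
  by rewrite truncn_le // powR_ge0.
apply: (@le_trans _ _ (N%:R `^ 0)); first by rewrite powRr0.
by apply: ler_powR; rewrite ?ler1n // addr_ge0 // ltW // eps_gt0.
Qed.

(** Over [gap N] indices below [N] the factor [1 + c * N `^ (- delta)]
    compounds to at least [c * N `^ eps], by Bernoulli's inequality; [q]
    such runs, with [q * eps >= 2], give [N ^+ 2] up to a constant. *)
Lemma far_ratio : exists (q : nat) (C : R), [/\ (0 < q)%N, 0 < C &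
  forall N i j, (i + q * gap N <= j)%N -> (j < N)%N -> u i / u j <= C * N%:R ^- 2].
Proof.
have e0 := eps_gt0.
pose q := (Num.truncn (2 / eps)).+1.
have qe : 2 <= eps * q%:R.
  by rewrite mulrC -ler_pdivrMr // ltW // truncnS_gt.
exists q, (c ^- q); split=> //; first by rewrite invr_gt0 exprn_gt0.
move=> N i j ij jN.
have N1 : 1 <= N%:R :> R by rewrite ler1n; lia.
have N0 : 0 < N%:R :> R by rewrite (lt_le_trans _ N1).
have ui := u_gt0 i; have uj := u_gt0 j.
have h : (1 + c * N%:R `^ (- delta)) ^+ (q * gap N) * u i <= u j.
  by apply: (le_trans (u_ratio (leq_ltn_trans ij jN))); exact: u_mono.
have x0 : 0 <= c * N%:R `^ (- delta) by rewrite mulr_ge0 ?powR_ge0 // ltW.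
have big_ : c ^+ q * N%:R ^+ 2 <= (1 + c * N%:R `^ (- delta)) ^+ (q * gap N).
  rewrite mulnC exprM.
  apply: (@le_trans _ _ ((c * N%:R `^ eps) ^+ q)).
    rewrite exprMn ler_wpM2l ?exprn_ge0 ?(ltW c_gt0) //.
    by rewrite -!powR_mulrn ?powR_ge0 ?ler0n // -powRrM ler_powR.
  apply: lerXn2r; rewrite ?nnegrE.
  - by rewrite mulr_ge0 ?powR_ge0 // ltW.
  - by rewrite exprn_ge0 // addr_ge0.
  apply: le_trans (bernoulli_le _ x0).
  rewrite -[leLHS]add0r lerD //.
  rewrite mulrCA ler_wpM2l ?(ltW c_gt0) //.
  apply: (@le_trans _ _ (N%:R `^ (delta + eps) * N%:R `^ (- delta))).
    by rewrite -powRD ?gt_eqF ?implybT // (addrC delta) addrK.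
  by rewrite ler_wpM2r ?powR_ge0 // gap_ge.
rewrite ler_pdivrMr // -invfM mulrC ler_pdivlMr ?mulr_gt0 ?exprn_gt0 //.
by rewrite mulrC; apply: le_trans h; rewrite ler_wpM2r // ltW.
Qed.

Lemma density_sq i : density i * density i = i.+1%:R `^ (- (2 * a)).
Proof. by rewrite /density -powRD ?pnatr_eq0 ?implybT // -opprD -mulr2n mulr_natl. Qed.

Lemma E_hit_at_le_density : exists C : R, 0 < C /\ forall i, E (hit_at i) <= C * density i.
Proof.
have [C [C0 h]] := inv_u_le; exists (1 + C); split; first by rewrite addr_gt0.
move=> i; have h1 := @E_hit_at_le i; have h2 := h i.
have h3 : C * i.+1%:R `^ (- (2 * a)) <= C * density i.
  by rewrite ler_wpM2l ?(ltW C0) // -density_sq ler_piMr ?density_le1 // ltW // density_gt0.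
by rewrite mulrDl mul1r; lra.
Qed.

Lemma inv_sq_le N i : (i < N)%N -> N%:R ^- 2 <= i.+1%:R `^ (- (2 * a)) :> R.
Proof.
move=> iN; have N0 : 0 < N%:R :> R by rewrite ltr0n; lia.
rewrite powRN lef_pV2 ?posrE ?exprn_gt0 ?powR_gt0 //.
apply: (@le_trans _ _ (N%:R `^ (2 * a))).
  by rewrite ge0_ler_powR ?nnegrE ?ler_nat // mulr_ge0 // ltW.
rewrite -powR_mulrn ?ler0n //; apply: ler_powR; first by rewrite ler1n; lia.
by move: a_delta delta_ge0; lra.
Qed.

Definition corr4 (i1 i2 i3 i4 : nat) : R := E (fun y => dev_at i1 y * dev_at i2 y * dev_at i3 y * dev_at i4 y).

(** If [i] and [j] are far apart, then the largest of the four indices is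
    far from the other three, and the correlation is negligible. In any
    case, since the lag [h] is long, [dev_at i] and [dev_at (i + h)] are
    nearly independent; bounding the other two factors by 1 leaves a product
    of two densities. *)
Lemma corr4_bounds : exists (q : nat) (C : R), [/\ (0 < q)%N, 0 < C,
  (forall N h i j, (q * gap N <= h)%N -> (i + h < N)%N -> (j + h < N)%N ->
     (i + q * gap N <= j)%N || (j + q * gap N <= i)%N ->
     corr4 i (i + h) j (j + h) <= C * N%:R ^- 2) &
  (forall N h i j, (q * gap N <= h)%N -> (i + h < N)%N ->
     corr4 i (i + h) j (j + h) <= C * i.+1%:R `^ (- (2 * a)))].
Proof.
have [q [C1 [q0 C10 far]]] := far_ratio; have [C2 [C20 Eb]] := E_hit_at_le_density.
have D0 := pts_rate_gt0.
(* the first summand serves the far pairs, the others the expansion of the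
   product of two hits, each increased by its density *)
pose C := 6 * pts_rate * C1 + 2 * pts_rate * C1 + 4 * (1 + C2).
exists q, C; split=> //; first by rewrite /C; nra.
  move=> N h i j; wlog ij : i j / (i <= j)%N.
    move=> wl qh iN jN ijK; have [ij|ij] := leqP i j; first exact: wl.
    have -> : corr4 i (i + h) j (j + h) = corr4 j (j + h) i (i + h).
      by apply: eq_Rintegral => y _; ring.
    by apply: wl => //; [exact: ltnW|rewrite orbC].
  move=> qh iN jN ijK.
  have {}ijK : (i + q * gap N <= j)%N by have : (0 < gap N)%N by []; nia.
  (* the second largest of the four indices *)
  pose m := maxn (i + h) j.
  have := @E_dev_at4_le i (i + h) j m (j + h).
  rewrite /m leq_maxl leq_maxr (leq_trans ij (leq_maxr _ _)) => /(_ isT isT isT).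
  rewrite -/m => /ler_normlW H.
  have -> : corr4 i (i + h) j (j + h) = E (fun y => dev_at (j + h) y * (dev_at i y * dev_at (i + h) y * dev_at j y)).
    by apply: eq_Rintegral => y _; ring.
  apply: (le_trans H).
  have mf : u m / u (j + h) <= C1 * N%:R ^- 2 by apply: far => //; rewrite /m; lia.
  have -> : 3 * pts_rate * u m * (2 / u (j + h)) = 6 * pts_rate * (u m / u (j + h)) by ring.
  apply: (@le_trans _ _ (6 * pts_rate * (C1 * N%:R ^- 2))).
    by rewrite ler_wpM2l // mulr_ge0 // ltW.
  rewrite mulrA ler_wpM2r ?invr_ge0 ?exprn_ge0 //.
  by rewrite /C; nra.
move=> N h i j qh iN.
have nw2 : bmeas (fun y => (hit_at i y + density i) * (hit_at (i + h) y + density (i + h))).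
  by apply: bmeasM; apply: bmeasD; (exact: bmeas_hit_at || exact: bmeas_cst).
apply: (@le_trans _ _ (E (fun y => (hit_at i y + density i) * (hit_at (i + h) y + density (i + h))))).
  apply: le_Rint01 => //; first by do 3 (apply: bmeasM; last exact: bmeas_dev_at); exact: bmeas_dev_at.
  move=> y _; apply: (le_trans (ler_norm _)).
  rewrite !normrM -mulrA -[leRHS]mulr1 ler_pM ?mulr_ge0 //.
    by apply: ler_pM => //; exact: norm_dev_at_le.
  by rewrite mulr_ile1 // dev_at_le1.
set k := (i + h)%N.
have pk : density k <= density i by apply: density_le; rewrite leq_addr.
have p0 := density_gt0 i; have p0' := density_gt0 k.
have -> : (fun y => (hit_at i y + density i) * (hit_at k y + density k)) =
   (fun y => hit_at i y * hit_at k y + (density i * hit_at k y + (density k * hit_at i y + density k * density i))).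
  by apply/funext => y; ring.
have nbb : bmeas (fun y => hit_at i y * hit_at k y) by apply: bmeasM; exact: bmeas_hit_at.
have nc x m : bmeas (fun y => x * hit_at m y) by apply: bmeasM; [exact: bmeas_cst|exact: bmeas_hit_at].
rewrite Rint01D //; last by do 2 (apply: bmeasD => //); exact: bmeas_cst.
rewrite Rint01D //; last by apply: bmeasD => //; exact: bmeas_cst.
rewrite Rint01D //; last exact: bmeas_cst.
rewrite Rint01_cst !Rint01Z; try exact: bmeas_hit_at.
have h1 := @E_hit_at2_le i k; have h2 := Eb i; have h3 := Eb k.
have far1 : u i / u k <= C1 * i.+1%:R `^ (- (2 * a)).
  apply: (@le_trans _ _ (C1 * N%:R ^- 2)); first by apply: far => //; rewrite leq_add2l.
  by rewrite ler_wpM2l ?(ltW C10) // inv_sq_le // (leq_ltn_trans (leq_addr h i)).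
rewrite -density_sq in far1 *.
have e1 : pts_rate * u i * (2 / u k) = 2 * pts_rate * (u i / u k) by ring.
rewrite e1 in h1.
have e2 : 2 * pts_rate * (u i / u k) <= 2 * pts_rate * (C1 * (density i * density i)).
  by rewrite ler_wpM2l // mulr_ge0 // ltW.
have e3 : density k * E (hit_at i) <= C2 * (density i * density i).
  apply: (@le_trans _ _ (density k * (C2 * density i))); first by rewrite ler_wpM2l // ltW.
  by rewrite mulrC -mulrA ler_wpM2l ?(ltW C20) // ler_wpM2l // ltW.
have e4 : density i * E (hit_at k) <= C2 * (density i * density i).
  apply: (@le_trans _ _ (density i * (C2 * density k))); first by rewrite ler_wpM2l // ltW.
  by rewrite mulrCA ler_wpM2l ?(ltW C20) // ler_wpM2l // ltW.
have e5 : density k * density i <= density i * density i by rewrite ler_wpM2r // ltW.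
have e6 : 0 <= pts_rate * C1 * (density i * density i) by rewrite !mulr_ge0 // ltW.
have e7 : 0 <= C2 * (density i * density i) by rewrite !mulr_ge0 // ltW.
by rewrite /C; nra.
Qed.

Definition autocov (N h : nat) (y : R) : R := \sum_(i < N - h) (dev_at i y * dev_at (i + h) y).

Definition autocov_sum (N : nat) (y : R) : R := \sum_(h < N) `|autocov N h y|.

Lemma bmeas_autocov N h : bmeas (autocov N h).
Proof. by apply: bmeas_sum => i; apply: bmeasM; exact: bmeas_dev_at. Qed.

Lemma bmeas_autocov_sum N : bmeas (autocov_sum N).
Proof. by apply: bmeas_sum => h; apply: bmeas_norm; exact: bmeas_autocov. Qed.

Lemma count_near (i K n : nat) : (\sum_(j < n) (~~ ((i + K <= j) || (j + K <= i))) <= 2 * K)%N.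
Proof.
apply: (@leq_trans (minn n (i + K) - (i.+1 - K))); last by lia.
elim: n => [|n ih]; first by rewrite big_ord0.
by rewrite big_ord_recr /= (leq_trans (leq_add ih (leqnn _))) //; lia.
Qed.

(** Expanding the square yields at most [N ^ 2] four-point correlations. The
    far pairs contribute [O(1)] altogether; each [i] has [O(gap N)] near
    partners, with the bound [i `^ (- (2 * a))] for each. *)
Lemma E_autocov_sq : exists (q : nat) (C : R), [/\ (0 < q)%N, 0 < C &
  forall N h, (q * gap N <= h)%N -> (h < N)%N ->
    E (fun y => autocov N h y ^+ 2) <= C * N%:R `^ (1 + delta + eps - 2 * a)].
Proof.
have [q [C [q0 C0 farb nearb]]] := corr4_bounds.
have a2 : 0 < 1 - 2 * a by move: a_delta delta_ge0; lra.
exists q, (C + 4 * q%:R * C / (1 - 2 * a)); split=> //.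
  by rewrite addr_gt0 // divr_gt0 // !mulr_gt0 // ltr0n.
move=> N h qh hN; set K := (q * gap N)%N; set n := (N - h)%N.
have N1 : (0 < N)%N by exact: leq_ltn_trans hN.
have NR : 0 < N%:R :> R by rewrite ltr0n.
have nN : (n <= N)%N by exact: leq_subr.
have ihN (i : 'I_n) : (i + h < N)%N by rewrite addnC -ltn_subRL ltn_ord.
have -> : E (fun y => autocov N h y ^+ 2) = \sum_(i < n) \sum_(j < n) corr4 i (i + h) j (j + h).
  rewrite (_ : (fun y => autocov N h y ^+ 2) =
     (fun y => \sum_(i < n) \sum_(j < n) (dev_at i y * dev_at (i + h) y * dev_at j y * dev_at (j + h) y))); last first.
    apply/funext => y; rewrite expr2 big_distrlr; apply: eq_bigr => i _.
    by apply: eq_bigr => j _; rewrite /= !mulrA.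
  have nf i j : bmeas (fun y => dev_at i y * dev_at (i + h) y * dev_at j y * dev_at (j + h) y).
    by do 3 (apply: bmeasM; last exact: bmeas_dev_at); exact: bmeas_dev_at.
  rewrite Rint01_sum; last by move=> i; apply: bmeas_sum => j.
  by apply: eq_bigr => i _; rewrite Rint01_sum.
have cb (i j : 'I_n) : corr4 i (i + h) j (j + h) <=
    C * N%:R ^- 2 + (~~ ((i + K <= j) || (j + K <= i))%N)%:R * (C * i.+1%:R `^ (- (2 * a))).
  have [ij|ij] /= := boolP ((i + K <= j) || (j + K <= i))%N.
    by rewrite mul0r addr0; apply: farb.
  rewrite mul1r -[leLHS]add0r; apply: lerD; last exact: (nearb N).
  by rewrite mulr_ge0 ?(ltW C0) // invr_ge0 exprn_ge0.
apply: (@le_trans _ _ (\sum_(i < n) (C / N%:R + (2 * K)%:R * (C * i.+1%:R `^ (- (2 * a)))))).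
  apply: ler_sum => i _.
  apply: (le_trans (ler_sum _ (fun j _ => cb i j))).
  rewrite big_split /= -mulr_suml lerD //.
    rewrite sumr_const card_ord -[C *+ n]mulr_natr mulrAC.
    apply: (@le_trans _ _ (C * N%:R ^- 2 * N%:R)).
      by rewrite ler_wpM2l ?ler_nat // mulr_ge0 ?(ltW C0) // invr_ge0 exprn_ge0.
    by rewrite expr2 invfM -!mulrA mulVf ?gt_eqF // mulr1.
  rewrite -mulr_suml ler_wpM2r ?mulr_ge0 ?powR_ge0 ?(ltW C0) //.
  by rewrite -natr_sum ler_nat count_near.
rewrite big_split /= sumr_const card_ord -!mulr_sumr -[X in X + _]mulr_natr [leRHS]mulrDl lerD //.
  apply: (@le_trans _ _ (C / N%:R * N%:R)).
    by rewrite ler_wpM2l ?ler_nat // divr_ge0 // ltW.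
  rewrite -mulrA mulVf ?gt_eqF // ler_wpM2l ?(ltW C0) //.
  apply: (@le_trans _ _ (N%:R `^ 0)); first by rewrite powRr0.
  apply: ler_powR; first by rewrite ler1n.
  by have := eps_gt0; move: delta_ge0 a_delta; rewrite /eps; lra.
have s2 : 0 < 2 * a < 1 by move: a2 a_gt0; lra.
have hs : \sum_(i < n) i.+1%:R `^ (- (2 * a)) <= N%:R `^ (1 - 2 * a) / (1 - 2 * a).
  apply: (le_trans (sum_powR_le n s2)).
  rewrite ler_wpM2r ?invr_ge0 ?(ltW a2) //.
  by rewrite ge0_ler_powR ?nnegrE ?ler_nat // ltW.
rewrite /K !natrM.
have gJ := gap_le N1.
have -> : 4 * q%:R * C / (1 - 2 * a) * N%:R `^ (1 + delta + eps - 2 * a) =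
   2 * (q%:R * (2 * N%:R `^ (delta + eps))) * (C * (N%:R `^ (1 - 2 * a) / (1 - 2 * a))).
  have -> : 1 + delta + eps - 2 * a = (delta + eps) + (1 - 2 * a) by ring.
  by rewrite powRD ?(gt_eqF NR) ?implybT //; ring.
apply: ler_pM.
- by rewrite !mulr_ge0.
- by rewrite mulr_ge0 ?(ltW C0) // sumr_ge0 // => i _; rewrite powR_ge0.
- by rewrite ler_wpM2l // ler_wpM2l.
- by rewrite ler_wpM2l // ltW.
Qed.

(** A crude bound, one factor of each product being replaced by 1; it is
    used for the lags that are too short for decorrelation. *)
Lemma E_norm_autocov : exists C : R, 0 < C /\
  forall N h, (0 < N)%N -> E (fun y => `|autocov N h y|) <= C * N%:R `^ (1 - a).
Proof.
have [C [C0 Eb]] := E_hit_at_le_density.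
have a1 : 0 < 1 - a by move: a_delta delta_ge0 a_gt0; lra.
exists ((1 + C) / (1 - a)); split; first by rewrite divr_gt0 // addr_gt0.
move=> N h N0; pose n := (N - h)%N.
have nw i : bmeas (fun y => hit_at i y + density i) by apply: bmeasD; [exact: bmeas_hit_at|exact: bmeas_cst].
apply: (@le_trans _ _ (E (fun y => \sum_(i < n) (hit_at i y + density i)))).
  apply: le_Rint01; [exact/bmeas_norm/bmeas_autocov|exact: bmeas_sum|].
  move=> y _; apply: (le_trans (ler_norm_sum _ _ _)); apply: ler_sum => i _.
  rewrite normrM -[leRHS]mulr1; apply: ler_pM => //; [exact: norm_dev_at_le|exact: dev_at_le1].
rewrite Rint01_sum //.
apply: (@le_trans _ _ (\sum_(i < n) ((1 + C) * density i))).
  apply: ler_sum => i _; rewrite Rint01D; [|exact: bmeas_hit_at|exact: bmeas_cst].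
  by rewrite Rint01_cst mulrDl mul1r addrC lerD2l.
rewrite -mulr_sumr -mulrA ler_wpM2l ?addr_ge0 ?(ltW C0) //.
have s1 : 0 < a < 1 by move: a1 a_gt0; lra.
apply: (le_trans (sum_powR_le n s1)); rewrite mulrC ler_wpM2l ?invr_ge0 ?(ltW a1) //.
by rewrite ge0_ler_powR ?nnegrE ?ler_nat ?leq_subr // ltW.
Qed.

(** The short lags are at most [q * gap N] in number. For the others the
    second moment controls the first by [`|x| <= t / 2 + x ^+ 2 / (2 * t)]. *)
Lemma E_autocov_sum : exists C : R, 0 < C /\
  forall N, (0 < N)%N -> E (autocov_sum N) <= C * N%:R `^ (2 - 2 * a - eps).
Proof.
have [q [C1 [q0 C10 H1]]] := E_autocov_sq; have [C2 [C20 H2]] := E_norm_autocov.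
have e0 := eps_gt0.
exists (2 * q%:R * C2 + (1 + C1) / 2); split.
  by rewrite addr_gt0 ?divr_gt0 ?addr_gt0 // !mulr_gt0 // ltr0n.
move=> N N0; have NR : 0 < N%:R :> R by rewrite ltr0n.
have N1 : 1 <= N%:R :> R by rewrite ler1n.
rewrite /autocov_sum Rint01_sum; last by move=> h; exact/bmeas_norm/bmeas_autocov.
(* the square root of the bound on the second moment balances the two terms
   [t / 2] and [x ^+ 2 / (2 * t)] *)
pose t : R := N%:R `^ ((1 + delta + eps - 2 * a) / 2).
have t0 : 0 < t by rewrite powR_gt0.
have tt : t * t = N%:R `^ (1 + delta + eps - 2 * a).
  by rewrite /t -powRD ?(gt_eqF NR) ?implybT // -splitr.
pose K := (q * gap N)%N.
have hb (h : 'I_N) : E (fun y => `|autocov N h y|) <= (h < K)%N%:R * (C2 * N%:R `^ (1 - a)) + (1 + C1) / 2 * t.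
  have [hK|hK] := ltnP h K.
    rewrite mul1r -[leLHS]addr0 lerD ?H2 //.
    by rewrite mulr_ge0 ?(ltW t0) // divr_ge0 // addr_ge0 // ltW.
  rewrite mul0r add0r.
  have nS2 : bmeas (fun y => t^-1 / 2 * autocov N h y ^+ 2).
    by apply: bmeasM; [exact: bmeas_cst|exact/bmeasX/bmeas_autocov].
  apply: (@le_trans _ _ (E (fun y => t / 2 + t^-1 / 2 * autocov N h y ^+ 2))).
    apply: le_Rint01; [exact/bmeas_norm/bmeas_autocov|by apply: bmeasD => //; exact: bmeas_cst|].
    move=> y _; rewrite -[autocov N h y ^+ 2]real_normK ?num_real //.
    set x := `|_|.
    have -> : t / 2 + t^-1 / 2 * x ^+ 2 = x + t^-1 / 2 * (x - t) ^+ 2.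
      by field; rewrite gt_eqF.
    by rewrite lerDl mulr_ge0 ?sqr_ge0 // divr_ge0 // invr_ge0 ltW.
  rewrite Rint01D //; last exact: bmeas_cst.
  rewrite Rint01_cst Rint01Z; last exact/bmeasX/bmeas_autocov.
  have := H1 N h hK (ltn_ord h); rewrite -tt => HS.
  have -> : (1 + C1) / 2 * t = t / 2 + t^-1 / 2 * (C1 * (t * t)) by field; rewrite gt_eqF.
  by rewrite lerD2l ler_wpM2l // divr_ge0 // invr_ge0 ltW.
apply: (le_trans (ler_sum _ (fun h _ => hb h))).
rewrite big_split /= -mulr_suml sumr_const card_ord [leRHS]mulrDl lerD //.
  have cK : \sum_(h < N) (h < K)%N%:R <= K%:R :> R.
    rewrite -natr_sum ler_nat.
    apply: (@leq_trans (minn N K)); last exact: geq_minr.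
    elim: (N) => [|m ih]; first by rewrite big_ord0.
    by rewrite big_ord_recr /= (leq_trans (leq_add ih (leqnn _))) //; clear; lia.
  apply: (@le_trans _ _ (q%:R * (2 * N%:R `^ (delta + eps)) * (C2 * N%:R `^ (1 - a)))).
    rewrite ler_wpM2r ?mulr_ge0 ?powR_ge0 ?(ltW C20) //.
    by apply: (le_trans cK); rewrite /K natrM ler_wpM2l // gap_le.
  have -> : q%:R * (2 * N%:R `^ (delta + eps)) * (C2 * N%:R `^ (1 - a)) =
     2 * q%:R * C2 * (N%:R `^ (delta + eps) * N%:R `^ (1 - a)) by ring.
  rewrite -powRD ?(gt_eqF NR) ?implybT // ler_wpM2l ?mulr_ge0 ?(ltW C20) //.
  by apply: ler_powR => //; rewrite /eps; move: a_gt0 delta_ge0 a_delta; lra.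
rewrite -[leLHS]mulr_natr -mulrA; apply: ler_wpM2l; first by rewrite divr_ge0 ?addr_ge0 ?(ltW C10).
rewrite -[X in t * X](powRr1 (ltW NR)) /t -powRD ?(gt_eqF NR) ?implybT //.
by apply: ler_powR => //; rewrite /eps; move: a_gt0 delta_ge0 a_delta; lra.
Qed.

End variance.

End correlations.

(** * Birkhoff's pointwise ergodic theorem *)

Section slope.
Variable R : realType.

(** Used instead of the condition that the limsup of [s n / n] is at most
    [c]: bounded changes of [s] preserve it for the very same [c], which
    makes the sets of points it defines exactly invariant, and it is a
    countable combination of closed conditions. *)
Definition slope_le (s : nat -> R) (c : R) : Prop := exists K : nat, forall n, s n <= c * n%:R + K%:R.

Lemma slope_le_le s c c' : c <= c' -> slope_le s c -> slope_le s c'.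
Proof.
move=> cc [K h]; exists K => n; apply: (le_trans (h n)).
by rewrite lerD2r ler_wpM2r.
Qed.

(** The limit is the infimum [L] of the slopes that dominate [s]: a rational
    slope [q] just below [L] does not dominate [s], so by the alternative
    every smaller slope is dominated by [s]. *)
Lemma slope_cvg (s : nat -> R) :
  (exists m : nat, slope_le s m%:R) ->
  (exists m : nat, slope_le (fun n => - s n) m%:R) ->
  (forall p q : rat, p < q -> slope_le s (ratr q) \/ slope_le (fun n => - s n) (- ratr p)) ->
  cvgn (fun n => n%:R^-1 * s n).
Proof.
move=> [m1 h1] [m2 h2] h.
pose B := [set c | slope_le s c].
have supB : has_inf B.
  split; first by exists m1%:R.
  exists (- m2%:R) => c [K hK]; rewrite leNgt; apply/negP => cm.
  have [K2 hK2] := h2.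
  have e0 : 0 < - m2%:R - c by rewrite subr_gt0.
  pose n := (Num.truncn ((K + K2)%:R / (- m2%:R - c))).+1.
  have nn : (K + K2)%:R / (- m2%:R - c) < n%:R by exact: truncnS_gt.
  rewrite ltr_pdivrMr // natrD in nn.
  by have := hK n; have := hK2 n; nra.
pose L := inf B.
have up e : 0 < e -> slope_le s (L + e).
  move=> e0; have [c' Bc cl] := inf_adherent e0 supB.
  exact: slope_le_le (ltW cl) Bc.
have lo e : 0 < e -> slope_le (fun n => - s n) (- (L - e)).
  move=> e0; have [q] : exists q : rat, ratr q \in `](L - e / 2), L[ by apply: rat_in_itvoo; lra.
  rewrite in_itv /= => /andP[q1 q2].
  have [p] : exists p : rat, ratr p \in `](L - e), (L - e / 2)[ by apply: rat_in_itvoo; lra.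
  rewrite in_itv /= => /andP[p1 p2].
  have pq : p < q by rewrite -(ltr_rat R); lra.
  have [Bq|nB] := h p q pq.
    have : L <= ratr q by apply: ge_inf => //; case: supB.
    by lra.
  by apply: slope_le_le nB; lra.
apply/cvg_ex; exists L; apply/cvgrPdist_le => e e0.
have e2 : 0 < e / 2 by rewrite divr_gt0.
have [K1 k1] := up _ e2; have [K2 k2] := lo _ e2.
exists (Num.truncn ((K1 + K2)%:R / (e / 2))).+1 => // n /= nn.
have n0 : 0 < n%:R :> R by rewrite ltr0n (leq_trans _ nn).
have Kn : (K1 + K2)%:R < n%:R * (e / 2).
  by rewrite -ltr_pdivrMr // (lt_le_trans (truncnS_gt _)) // ler_nat.
rewrite natrD in Kn.
have u1 := k1 n; have u2 := k2 n.
have -> : L - n%:R^-1 * s n = (L * n%:R - s n) / n%:R by field; rewrite gt_eqF.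
rewrite normrM normfV (ger0_norm (ltW n0)) ler_pdivrMr // ler_norml.
have K10 : 0 <= K1%:R :> R by []. have K20 : 0 <= K2%:R :> R by [].
by apply/andP; split; lra.
Qed.
End slope.

Section system.
Context (R : realType) (d : measure_display) (X : measurableType d).
Variable mu : probability X R.

Lemma measurable_iterT (T : X -> X) n : measurable_fun setT T -> measurable_fun setT (iter n T).
Proof. by move=> mT; elim: n => [|n ih] /=; [exact: measurable_id|exact: measurableT_comp mT ih]. Qed.

Lemma mp_iter (T : X -> X) n : measure_preserving mu T -> measure_preserving mu (iter n T).
Proof.
move=> [mT pT]; elim: n => [|n [mi pi]] /=; first by split=> //; exact: measurable_id.
split; first exact: measurableT_comp.
move=> A mA; rewrite (_ : _ @^-1` A = iter n T @^-1` (T @^-1` A)) // pi ?pT //.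
by rewrite -[X in measurable X]setTI; exact: mT.
Qed.

Section change_of_variables.
Variable T : X -> X.
Hypothesis mp : measure_preserving mu T.
Let mT : measurable_fun setT T := mp.1.

Lemma ge0_integral_mp (f : X -> \bar R) : measurable_fun setT f -> (forall x, 0 <= f x)%E ->
  (\int[mu]_x f (T x) = \int[mu]_x f x)%E.
Proof.
move=> mf f0.
have := @ge0_integral_pushforward _ _ _ _ R T mT mu setT f measurableT mf (fun y _ => f0 y).
rewrite preimage_setT => <-.
apply: (@eq_measure_integral _ _ _ _ mu (measure_function_pushforward__canonical__measure_function_Measure mu mT)) => A mA _.
by rewrite /= /pushforward mp.2.
Qed.

Lemma integrable_mp (f : X -> R) : mu.-integrable setT (EFin \o f) ->
  mu.-integrable setT (EFin \o (f \o T)).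
Proof.
move=> /integrableP[mf If]; apply/integrableP; split.
  exact: (measurableT_comp mf mT).
have := @ge0_integral_mp (abse \o (EFin \o f)) (measurableT_comp _ mf) (fun x => abse_ge0 _).
by move=> /= ->.
Qed.

Lemma Rintegral_mp (f : X -> R) : mu.-integrable setT (EFin \o f) ->
  \int[mu]_x f (T x) = \int[mu]_x f x.
Proof.
move=> If; have := integrable_mp If.
move/integrableP : If => [mf _] IfT; congr fine.
have := @integral_pushforward _ _ _ _ R T mT mu setT (EFin \o f) mf.
rewrite preimage_setT => /(_ IfT measurableT) /= <-.
apply: (@eq_measure_integral _ _ _ _ mu (measure_function_pushforward__canonical__measure_function_Measure mu mT)) => A mA _.
by rewrite /= /pushforward mp.2.
Qed.

Lemma ae_mp (P : X -> Prop) : {ae mu, forall x, P x} -> {ae mu, forall x, P (T x)}.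
Proof.
move=> [N [mN N0 PN]]; exists (T @^-1` N); split.
- by rewrite -[X in measurable X]setTI; exact: mT.
- by rewrite mp.2.
- by move=> x /= nP; apply: PN.
Qed.
End change_of_variables.

Section maximal.
Variable T : X -> X.
Hypothesis mp : measure_preserving mu T.
Let mT : measurable_fun setT T := mp.1.

Definition birkhoff_sum (f : X -> R) (n : nat) (x : X) : R := \sum_(j < n) f (iter j T x).

Lemma birkhoff_sumS f n x : birkhoff_sum f n.+1 x = f x + birkhoff_sum f n (T x).
Proof.
rewrite /birkhoff_sum big_ord_recl; congr (_ + _); apply: eq_bigr => i _.
by rewrite -iterSr.
Qed.

Lemma measurable_birkhoff_sum f n : measurable_fun setT f -> measurable_fun setT (birkhoff_sum f n).
Proof.
move=> mf; rewrite /birkhoff_sum; apply: measurable_sum => i.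
by apply: measurableT_comp => //; exact: measurable_iterT.
Qed.

(** Garsia's recursion for the maximum of 0 and of the first [n] sums,
    written so that the maximum at [T x] appears. *)
Fixpoint birkhoff_max (f : X -> R) (n : nat) (x : X) : R :=
  if n is n'.+1 then Num.max 0 (f x + birkhoff_max f n' (T x)) else 0.

Lemma birkhoff_max_ge0 f n x : 0 <= birkhoff_max f n x.
Proof. by case: n => //= n; rewrite le_max lexx. Qed.

Lemma birkhoff_max_le f n x : birkhoff_max f n x <= birkhoff_max f n.+1 x.
Proof.
elim: n x => [|n ih] x; first exact: birkhoff_max_ge0.
rewrite /= -/(birkhoff_max f n.+1 (T x)).
by rewrite ge_max !le_max lexx /= lerD2l ih orbT.
Qed.

Lemma birkhoff_max_mono f n m x : (n <= m)%N -> birkhoff_max f n x <= birkhoff_max f m x.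
Proof.
elim: m => [|m ih]; first by rewrite leqn0 => /eqP ->.
rewrite leq_eqVlt => /predU1P[->//|/ih h]; exact: le_trans h (birkhoff_max_le _ _ _).
Qed.

Lemma birkhoff_sum_le_birkhoff_max f n x : birkhoff_sum f n x <= birkhoff_max f n x.
Proof.
elim: n x => [|n ih] x; first by rewrite /birkhoff_sum big_ord0.
by rewrite birkhoff_sumS /= le_max lerD2l ih orbT.
Qed.

Lemma integrable_birkhoff_max f n : mu.-integrable setT (EFin \o f) ->
  mu.-integrable setT (EFin \o birkhoff_max f n).
Proof.
move=> If; have mf : measurable_fun setT f by apply/measurable_EFinP; case/integrableP : If.
elim: n => [|n ih]; first by rewrite (_ : _ \o _ = cst 0%E) //; exact: integrable0.
have IS : mu.-integrable setT (EFin \o (fun x => f x + birkhoff_max f n (T x))).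
  by have := integrableD measurableT If (integrable_mp mp ih).
have /integrableP[/measurable_EFinP mIS _] := IS.
apply: le_integrable IS => //.
  by apply/measurable_EFinP; apply: measurable_maxr.
move=> x _ /=; rewrite lee_fin (ger0_norm (birkhoff_max_ge0 f n.+1 x)) ge_max normr_ge0 /=.
exact: ler_norm.
Qed.

(** Where the maximum at [x] is positive, it is [f x] plus a previous
    maximum at [T x], hence at most [f x] plus the maximum at [T x];
    elsewhere it is 0. As [T] preserves the measure, the two maxima have
    equal integrals, which cancel. *)
Lemma garsia f n : mu.-integrable setT (EFin \o f) ->
  0 <= \int[mu]_x (f x * (0 < birkhoff_max f n x)%R%:R).
Proof.
move=> If; have Ib := integrable_birkhoff_max n If.
have IbT := integrable_mp mp Ib.
have mf : measurable_fun setT f by apply/measurable_EFinP; case/integrableP : If.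
have mb : measurable_fun setT (birkhoff_max f n) by apply/measurable_EFinP; case/integrableP : Ib.
have I1 : mu.-integrable setT (EFin \o (fun x => f x * (0 < birkhoff_max f n x)%R%:R)).
  apply: le_integrable If => //.
    apply/measurable_EFinP; apply: measurable_funM => //.
    apply: (@measurableT_comp _ _ _ _ _ _ (fun b : bool => b%:R : R)) => //.
    by apply: measurable_fun_ltr.
  move=> x _ /=; rewrite lee_fin normrM.
  by case: (0 < _); rewrite ?normr1 ?mulr1 // normr0 mulr0.
have : \int[mu]_x (birkhoff_max f n x - birkhoff_max f n (T x)) <= \int[mu]_x (f x * (0 < birkhoff_max f n x)%R%:R).
  apply: le_Rintegral => //; first exact: (integrableB measurableT Ib IbT).
  move=> x _; have := birkhoff_max_ge0 f n (T x).
  have [b0|b0] := ltP 0 (birkhoff_max f n x).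
    rewrite mulr1 => _; case: n {Ib IbT mb I1} b0 => [|n]; first by rewrite ltxx.
    move=> b0; have := birkhoff_max_le f n (T x); have -> : birkhoff_max f n.+1 x = f x + birkhoff_max f n (T x).
      by move: b0 => /=; rewrite lt_max ltxx /= => b0; apply/max_idPr/ltW.
    by lra.
  by rewrite mulr0; lra.
by rewrite RintegralB // Rintegral_mp // subrr.
Qed.

(** The sets where the successive maxima are positive exhaust the support of
    [f]. *)
Lemma maximal_ergodic f : mu.-integrable setT (EFin \o f) ->
  (forall x, f x != 0 -> exists n, 0 < birkhoff_sum f n x) -> 0 <= \int[mu]_x f x.
Proof.
move=> If h.
have mf : measurable_fun setT f by apply/measurable_EFinP; case/integrableP : If.
have := @dominated_convergence _ _ R mu setT measurableT
  (fun n x => (f x * (0 < birkhoff_max f n x)%R%:R)%:E) (EFin \o f) (abse \o (EFin \o f)).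
case=> //.
- move=> n; apply/measurable_EFinP; apply: measurable_funM => //.
  apply: (@measurableT_comp _ _ _ _ _ _ (fun b : bool => b%:R : R)) => //.
  apply: measurable_fun_ltr => //; apply/measurable_EFinP.
  by case/integrableP : (integrable_birkhoff_max n If).
- exact/measurable_EFinP.
- apply: aeW => x _; have [fx0|fx] := eqVneq (f x) 0.
    by apply: cvg_near_cst; apply: nearW => n /=; rewrite fx0 mul0r.
  have [n hn] := h x fx; apply: cvg_near_cst; exists n => // m /= nm.
  by rewrite (lt_le_trans hn (le_trans (birkhoff_sum_le_birkhoff_max f n x) (birkhoff_max_mono f x nm))) mulr1.
- exact: integrable_abse.
- apply: aeW => x n _ /=; rewrite lee_fin normrM.
  by case: (0 < _); rewrite ?normr1 ?mulr1 // normr0 mulr0.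
move=> _ _ cv.
have mb n : measurable_fun setT (birkhoff_max f n).
  by apply/measurable_EFinP; case/integrableP : (integrable_birkhoff_max n If).
rewrite -lee_fin /Rintegral fineK; last exact: integrable_fin_num.
apply: (cvge_ge _ cv); apply: nearW => n /=.
have := garsia n If; rewrite -lee_fin /Rintegral fineK //.
apply: integrable_fin_num => //.
apply: le_integrable If => //.
  apply/measurable_EFinP; apply: measurable_funM => //.
  apply: (@measurableT_comp _ _ _ _ _ _ (fun b : bool => b%:R : R)) => //.
  exact: measurable_fun_ltr.
move=> x _ /=; rewrite lee_fin normrM.
by case: (0 < _); rewrite ?normr1 ?mulr1 // normr0 mulr0.
Qed.
End maximal.

Section birkhoff.
Variable T : X -> X.
Hypothesis mp : measure_preserving mu T.
Let mT : measurable_fun setT T := mp.1.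

Lemma birkhoff_sumN f n x : birkhoff_sum T (fun x => - f x) n x = - birkhoff_sum T f n x.
Proof. by rewrite /birkhoff_sum sumrN. Qed.

(** Passing from [x] to [T x] shifts the index by one and drops the term [f
    x], a bounded change. *)
Lemma slope_le_T f c x : slope_le (birkhoff_sum T f ^~ (T x)) c <-> slope_le (birkhoff_sum T f ^~ x) c.
Proof.
have [N0 hN0] : exists N0 : nat, `|f x| + `|c| <= N0%:R.
  by exists (Num.truncn (`|f x| + `|c|)).+1; rewrite ltW // truncnS_gt.
have := ler_norm (f x); have := ler_norm c; have := ler_norm (- f x); have := ler_norm (- c).
rewrite !normrN => c1 c2 c3 c4.
split=> -[K h]; exists (K + N0)%N; last first.
  by move=> n; have := h n.+1; rewrite birkhoff_sumS natrD -natr1; lra.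
case=> [|n]; first by rewrite /birkhoff_sum big_ord0 mulr0 add0r.
by have := h n; rewrite birkhoff_sumS natrD -natr1; lra.
Qed.

Lemma measurable_slope_le f c : measurable_fun setT f ->
  measurable [set x | slope_le (birkhoff_sum T f ^~ x) c].
Proof.
move=> mf.
rewrite (_ : [set _ | _] = \bigcup_(K : nat) \bigcap_(n : nat)
   (birkhoff_sum T f n @^-1` [set` `]-oo, (c * n%:R + K%:R)]])); last first.
  apply/seteqP; split => x /=.
    by move=> [K h]; exists K => // n _ /=; rewrite in_itv /=.
  by move=> [K _ h]; exists K => n; have := h n I; rewrite /= in_itv.
apply: bigcupT_measurable => K; apply: bigcapT_measurable => n.
rewrite -[X in measurable X]setTI.
by apply: (measurable_birkhoff_sum mp n mf) => //; exact: measurable_itv.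
Qed.

Lemma integrable_mul_indic f (E : set X) : measurable E -> mu.-integrable setT (EFin \o f) ->
  mu.-integrable setT (EFin \o (fun x => f x * \1_E x)).
Proof.
move=> mE If; have mf : measurable_fun setT f by apply/measurable_EFinP; case/integrableP : If.
apply: le_integrable If => //.
  by apply/measurable_EFinP; apply: measurable_funM => //; exact: measurable_indic.
move=> x _ /=; rewrite lee_fin normrM indicE.
by case: (_ \in _); rewrite ?normr1 ?mulr1 // normr0 mulr0.
Qed.

Lemma Rintegral_indicT (E : set X) : measurable E -> \int[mu]_x \1_E x = fine (mu E).
Proof. by move=> mE; rewrite /Rintegral integral_indic // setIT. Qed.

Lemma integrableNR f : mu.-integrable setT (EFin \o f) ->
  mu.-integrable setT (EFin \o (fun x => - f x)).
Proof.
move=> If; have := integrableN If.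
by apply: eq_integrable.
Qed.

Lemma integrableB_cst f c : mu.-integrable setT (EFin \o f) ->
  mu.-integrable setT (EFin \o (fun x => f x - c)).
Proof.
move=> If; have := integrableB measurableT If (finite_measure_integrable_cst mu c measurableT).
by [].
Qed.

(** On [E] some sum of [f - c] is positive, for otherwise [slope_le] would
    hold with constant 0. The exact invariance of [E] lets its indicator be
    taken out of the sums. *)
Lemma maximal_on f c (E : set X) : mu.-integrable setT (EFin \o f) -> measurable E ->
  (forall x, E (T x) <-> E x) -> (forall x, E x -> ~ slope_le (birkhoff_sum T f ^~ x) c) ->
  c * fine (mu E) <= \int[mu]_x (f x * \1_E x).
Proof.
move=> If mE TE Eb.
have Ic := integrableB_cst c If.
have := @maximal_ergodic T mp (fun x => (f x - c) * \1_E x) (integrable_mul_indic mE Ic).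
have iterE n x : \1_E (iter n T x) = \1_E x :> R.
  elim: n => //= n <-; rewrite !indicE; congr ((_ : bool)%:R).
  by apply/idP/idP; rewrite !inE => /TE.
have -> : \int[mu]_x ((f x - c) * \1_E x) = \int[mu]_x (f x * \1_E x) - c * fine (mu E).
  rewrite -Rintegral_indicT // -RintegralZl //; last first.
    have := integrable_mul_indic mE (finite_measure_integrable_cst mu 1 measurableT).
    by apply: eq_integrable => // x _ /=; rewrite mul1r.
  rewrite -RintegralB //.
  - by apply: eq_Rintegral => x _; rewrite mulrBl.
  - exact: integrable_mul_indic.
  - exact: (integrable_mul_indic mE (finite_measure_integrable_cst mu c measurableT)).
rewrite subr_ge0; apply => x.
rewrite mulf_eq0 negb_or => /andP[_ xE].
have {xE} Ex : E x by move: xE; rewrite indicE; case: (boolP (x \in E)); rewrite ?eqxx // inE.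
apply: contrapT => nex; apply: (Eb x Ex); exists 0%N => n; rewrite addr0.
rewrite leNgt; apply/negP => hn; apply: nex; exists n.
rewrite /birkhoff_sum; under eq_bigr do rewrite iterE.
rewrite -mulr_suml indicE mem_set // mulr1 sumrB sumr_const card_ord -mulr_natr.
by rewrite subr_gt0.
Qed.

(** On the invariant set where both alternatives fail, [maximal_on] bounds
    the integral of [f] from below by [q] times the measure and from above
    by [p] times the measure. *)
Lemma ae_slope_dichotomy f (p q : R) : mu.-integrable setT (EFin \o f) -> p < q ->
  {ae mu, forall x, slope_le (birkhoff_sum T f ^~ x) q \/ slope_le (fun n => - birkhoff_sum T f n x) (- p)}.
Proof.
move=> If pq.
have mf : measurable_fun setT f by apply/measurable_EFinP; case/integrableP : If.
have IfN : mu.-integrable setT (EFin \o (fun x => - f x)) by exact: integrableNR.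
have mfN : measurable_fun setT (fun x => - f x) by exact: measurable_funN.
pose E := ~` [set x | slope_le (birkhoff_sum T f ^~ x) q] `&` ~` [set x | slope_le (birkhoff_sum T (fun x => - f x) ^~ x) (- p)].
have mE : measurable E by apply: measurableI; apply: measurableC; exact: measurable_slope_le.
have TE x : E (T x) <-> E x.
  split=> -[h1 h2]; split=> /=.
  - by move=> /(slope_le_T f).
  - by move=> /(slope_le_T (fun x => - f x)).
  - by move=> /(slope_le_T f).
  - by move=> /(slope_le_T (fun x => - f x)).
have h1 := maximal_on If mE TE (fun x h => h.1).
have h2 := maximal_on IfN mE TE (fun x h => h.2).
have h3 : \int[mu]_x (- f x * \1_E x) = - \int[mu]_x (f x * \1_E x).
  rewrite -mulN1r -RintegralZl //; last exact: integrable_mul_indic.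
  by apply: eq_Rintegral => x _; ring.
have E0 : mu E = 0%E.
  have := measure_ge0 mu E; rewrite le_eqVlt => /predU1P[<-//|E0].
  have : 0 < fine (mu E) by rewrite fine_gt0 // E0 (le_lt_trans (probability_le1 mu mE)) // ltey.
  by move: h1 h2; rewrite h3 => h1 h2 m0; exfalso; nra.
exists E; split=> // x /= /not_orP[n1 n2]; split=> //=.
by under eq_fun do rewrite birkhoff_sumN.
Qed.

(** By [maximal_on], the set where [m] is not such a bound has measure at
    most the integral of [`|f|] divided by [m]. *)
Lemma ae_slope_le f : mu.-integrable setT (EFin \o f) ->
  {ae mu, forall x, exists m : nat, slope_le (birkhoff_sum T f ^~ x) m%:R}.
Proof.
move=> If.
have mf : measurable_fun setT f by apply/measurable_EFinP; case/integrableP : If.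
pose E m := ~` [set x | slope_le (birkhoff_sum T f ^~ x) m%:R].
have mE m : measurable (E m) by apply: measurableC; exact: measurable_slope_le.
have mEE : measurable (\bigcap_m E m) by exact: bigcapT_measurable.
have TE m x : E m (T x) <-> E m x by rewrite /E /=; split=> h /(slope_le_T f).
exists (\bigcap_m E m); split=> //; last by move=> x /= /forallNP h m _; exact: h.
have In : mu.-integrable setT (EFin \o (fun x => `|f x|)) by exact: integrable_norm.
pose B := \int[mu]_x `|f x|.
have bound m : m%:R * fine (mu (\bigcap_m E m)) <= B.
  apply: (@le_trans _ _ (m%:R * fine (mu (E m)))).
    rewrite ler_wpM2l // fine_le ?fin_num_measure // le_measure ?inE //.
    exact: bigcap_inf.
  apply: (le_trans (maximal_on If (mE m) (TE m) (fun x h => h))).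
  apply: le_Rintegral => //; first exact: integrable_mul_indic.
  move=> x _; rewrite indicE; case: (_ \in _); rewrite ?mulr1 ?mulr0 //; exact: ler_norm.
have := measure_ge0 mu (\bigcap_m E m); rewrite le_eqVlt => /predU1P[<-//|E0].
have e0 : 0 < fine (mu (\bigcap_m E m)).
  by rewrite fine_gt0 // E0 (le_lt_trans (probability_le1 mu mEE)) // ltey.
have := bound (Num.truncn (B / fine (mu (\bigcap_m E m)))).+1.
by rewrite leNgt -ltr_pdivrMr // truncnS_gt.
Qed.

(** The exceptional sets of [ae_slope_dichotomy] are collected over the
    countably many pairs of rationals. *)
Theorem birkhoff f : mu.-integrable setT (EFin \o f) ->
  {ae mu, forall x, cvgn (fun n => n%:R^-1 * birkhoff_sum T f n x)}.
Proof.
move=> If.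
have IfN : mu.-integrable setT (EFin \o (fun x => - f x)) by exact: integrableNR.
have h1 := ae_slope_le If; have h2 := ae_slope_le IfN.
have h3 : {ae mu, forall x, forall n, forall p q : rat, unpickle n = Some (p, q) -> p < q ->
   slope_le (birkhoff_sum T f ^~ x) (ratr q) \/ slope_le (fun n => - birkhoff_sum T f n x) (- ratr p)}.
  apply: ae_foralln => n.
  case E : (unpickle n) => [[p q]|]; last by apply: aeW.
  have [pq|pq] := boolP (p < q); last by apply: aeW => x p' q' [<- <-]; rewrite (negbTE pq).
  have := @ae_slope_dichotomy f (ratr p) (ratr q) If; rewrite ltr_rat => /(_ pq).
  by apply: filterS => x h p' q' [<- <-].
move: h1 h2 h3; apply: filterS3 => x h1 h2 h3.
apply: slope_cvg => //.
- by have [m hm] := h2; exists m; under eq_fun do rewrite -birkhoff_sumN.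
- by move=> p q pq; apply: (h3 (pickle (p, q))) => //; rewrite pickleK.
Qed.
End birkhoff.

(** * Mean-square limits and conditional expectations *)

Section averages.
Variable T : X -> X.
Hypothesis mp : measure_preserving mu T.
Let mT : measurable_fun setT T := mp.1.
Local Notation avg s f N := (@ergodic_average R X T s f N).

Lemma sum_from1 (F : nat -> R) N : \sum_(1 <= n < N.+1) F n = \sum_(i < N) F i.+1.
Proof. by rewrite big_add1 /= big_mkord. Qed.

Lemma measurable_avg s f N : measurable_fun setT f -> measurable_fun setT (avg s f N).
Proof.
move=> mf; apply: measurable_funM => //; apply: measurable_sum => n.
by apply: measurableT_comp => //; exact: measurable_iterT.
Qed.

Lemma avgB s f g N x : avg s (fun x => f x - g x) N x = avg s f N x - avg s g N x.
Proof. by rewrite /ergodic_average sumrB mulrBr. Qed.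

Lemma jensen_sq (F : nat -> R) N :
  (N%:R^-1 * \sum_(i < N) F i) ^+ 2 <= N%:R^-1 * \sum_(i < N) F i ^+ 2.
Proof.
case: N => [|N]; first by rewrite !big_ord0 !mulr0 expr0n.
set n : R := N.+1%:R; have n0 : 0 < n by rewrite ltr0n.
set m := n^-1 * _.
have : 0 <= n^-1 * \sum_(i < N.+1) (F i - m) ^+ 2.
  by rewrite mulr_ge0 ?invr_ge0 ?(ltW n0) // sumr_ge0 // => i _; exact: sqr_ge0.
under eq_bigr do rewrite sqrrB.
rewrite big_split /= sumrB sumr_const card_ord -mulr_natr -/n.
rewrite sumrMnl -mulr_suml.
have -> : \sum_(i < N.+1) F i = n * m by rewrite /m mulrA mulfV ?gt_eqF // mul1r.
set Q := \sum_(i < _) F i ^+ 2.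
have -> : n^-1 * (Q - n * m * m *+ 2 + m ^+ 2 * n) = n^-1 * Q - m ^+ 2.
  by field; rewrite gt_eqF.
by rewrite subr_ge0.
Qed.

(** Convexity and invariance of the measure, whatever the sequence of times. *)
Lemma int_avg_sq s (f : X -> R) N : measurable_fun setT f ->
  (\int[mu]_x ((avg s f N x) ^+ 2)%:E <= \int[mu]_x ((f x) ^+ 2)%:E)%E.
Proof.
move=> mf.
have mf2 : measurable_fun setT (fun x => ((f x) ^+ 2)%:E).
  by apply/measurable_EFinP; exact: measurable_funX.
have I0 : (0 <= \int[mu]_x ((f x) ^+ 2)%:E)%E.
  by apply: integral_ge0 => x _; rewrite lee_fin sqr_ge0.
apply: (@le_trans _ _ (\int[mu]_x (N%:R^-1%:E * \sum_(i < N) ((f (iter (s i.+1) T x)) ^+ 2)%:E))%E).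
  apply: ge0_le_integral => //.
  - by move=> x _; rewrite lee_fin sqr_ge0.
  - by apply/measurable_EFinP/measurable_funX/measurable_avg.
  - apply: measurable_funeM; apply: emeasurable_sum => i.
    exact: (measurableT_comp mf2 (measurable_iterT _ _)).
  - move=> x _; rewrite sumEFin -EFinM lee_fin /ergodic_average sum_from1.
    exact: (jensen_sq (fun i => f (iter (s i.+1) T x))).
have mi i : measurable_fun setT (fun x => ((f (iter (s i.+1) T x)) ^+ 2)%:E).
  exact: (measurableT_comp mf2 (measurable_iterT _ _)).
have si0 i x : (0 <= ((f (iter (s i) T x)) ^+ 2)%:E)%E by rewrite lee_fin sqr_ge0.
have ms : measurable_fun setT (fun x => (\sum_(i < N) ((f (iter (s i.+1) T x)) ^+ 2)%:E)%E).
  by apply: emeasurable_sum => i.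
have s0 x : setT x -> (0 <= \sum_(i < N) ((f (iter (s i.+1) T x)) ^+ 2)%:E)%E.
  by move=> _; apply: sume_ge0 => i _.
rewrite ge0_integralZl // ge0_integral_sum //.
under eq_bigr => i _.
  rewrite (@ge0_integral_mp _ (mp_iter (s i.+1) mp) (fun x => ((f x) ^+ 2)%:E) mf2); last first.
    by move=> x; rewrite lee_fin sqr_ge0.
  over.
clear ms s0; case: N => [|N]; first by rewrite big_ord0 mule0.
move: I0; case: (\int[mu]_x _)%E => [r||] // r0; last by rewrite leey.
rewrite sumEFin -EFinM lee_fin sumr_const card_ord -[X in _ * X]mulr_natl mulrA mulVf ?mul1r //.
Qed.

Lemma fatou_sq (v : nat -> X -> R) (w : X -> R) (C : \bar R) :
  (forall n, measurable_fun setT (v n)) -> measurable_fun setT w ->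
  {ae mu, forall x, v n x @[n --> \oo] --> w x} ->
  (forall n, \int[mu]_x ((v n x) ^+ 2)%:E <= C)%E ->
  (\int[mu]_x ((w x) ^+ 2)%:E <= C)%E.
Proof.
move=> mv mw vw vC.
have mv2 n : measurable_fun setT (fun x => ((v n x) ^+ 2)%:E).
  by apply/measurable_EFinP; exact: measurable_funX.
have := @fatou _ _ R mu setT measurableT (fun n x => ((v n x) ^+ 2)%:E) mv2.
move=> /(_ (fun n x _ => _)); rewrite /= => H.
have H0 n x : (0 <= ((v n x) ^+ 2)%:E)%E by rewrite lee_fin sqr_ge0.
have {}H := H H0.
have -> : (\int[mu]_x ((w x) ^+ 2)%:E = \int[mu]_x limn_einf (fun n => ((v n x) ^+ 2)%:E))%E.
  apply: ge0_ae_eq_integral => //.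
  - by apply/measurable_EFinP; exact: measurable_funX.
  - rewrite /limn_einf; apply: measurableT_comp => //.
    by apply: measurable_fun_limn_esup => n; exact: measurableT_comp.
  - by move=> x _; rewrite lee_fin sqr_ge0.
  - move=> x _; rewrite limn_einf_lim; apply: lime_ge; first exact: is_cvg_einfs.
    by apply: nearW => n; apply: le_ereal_inf_tmp => _ [m /= nm <-].
  - apply: filterS vw => x vx _; apply/esym.
    apply: (cvg_limn_einf_sup _).1; apply/cvg_EFin; first exact: nearW.
    by rewrite /=; apply: cvgM.
apply: (le_trans H); apply: (le_trans (limn_einf_sup _)); rewrite limn_esup_lim.
apply: lime_le; first exact: is_cvg_esups.
by apply: nearW => n; apply: ge_ereal_sup => _ [m /= nm <-].
Qed.

Lemma cvge0P (v : nat -> \bar R) : (forall n, 0 <= v n)%E ->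
  (v n @[n --> \oo] --> 0%E) <-> (forall e : R, 0 < e -> \forall n \near \oo, (v n <= e%:E)%E).
Proof.
move=> v0; split=> [/fine_cvgP[vf /cvgrPdist_le vc] e e0|h].
  move: vf (vc e e0); apply: filterS2 => n /fineK <- /=.
  by rewrite sub0r normrN lee_fin => /ler_normlW.
apply/fine_cvgP; split.
  apply: filterS (h 1 ltr01) => n vn; rewrite ge0_fin_numE //.
  exact: le_lt_trans vn (ltey _).
apply/cvgrPdist_le => e e0; apply: filterS (h e e0) => n vn /=.
rewrite sub0r normrN ger0_norm ?fine_ge0 // -lee_fin fineK // ge0_fin_numE //.
exact: le_lt_trans vn (ltey _).
Qed.

Definition truncate (M : nat) (f : X -> R) (x : X) : R := f x * (`|f x| <= M%:R)%R%:R.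

Lemma measurable_truncate M f : measurable_fun setT f -> measurable_fun setT (truncate M f).
Proof.
move=> mf; apply: measurable_funM => //.
apply: (@measurableT_comp _ _ _ _ _ _ (fun b : bool => b%:R : R)) => //.
by apply: measurable_fun_ler => //; exact: measurableT_comp.
Qed.

Lemma truncate_bound M f x : `|truncate M f x| <= M%:R.
Proof.
rewrite /truncate; have [h|h] := boolP (`|f x| <= M%:R); first by rewrite mulr1.
by rewrite mulr0 normr0.
Qed.

Lemma int_truncate_cvg (f : X -> R) : measurable_fun setT f -> (\int[mu]_x ((f x) ^+ 2)%:E < +oo)%E ->
  (\int[mu]_x ((f x - truncate M f x) ^+ 2)%:E)%E @[M --> \oo] --> 0%E.
Proof.
move=> mf f2.
have If2 : mu.-integrable setT (fun x => ((f x) ^+ 2)%:E).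
  apply/integrableP; split; first by apply/measurable_EFinP; exact: measurable_funX.
  by under eq_integral do rewrite /= ger0_norm ?sqr_ge0 //.
have := @dominated_convergence _ _ R mu setT measurableT
  (fun M x => ((f x - truncate M f x) ^+ 2)%:E) (cst 0%E) (fun x => ((f x) ^+ 2)%:E).
case=> //.
- move=> M; apply/measurable_EFinP; apply: measurable_funX; apply: measurable_funB => //.
  exact: measurable_truncate.
- apply: aeW => x _; apply: cvg_near_cst.
  exists (Num.truncn `|f x|).+1 => // M /= fM.
  rewrite /truncate (_ : `|f x| <= M%:R); first by rewrite mulr1 subrr expr0n.
  by rewrite ltW // (lt_le_trans (truncnS_gt _)) // ler_nat.
- apply: aeW => x M _ /=; rewrite lee_fin ger0_norm ?sqr_ge0 // /truncate.
  by case: (`|f x| <= M%:R); rewrite ?mulr1 ?subrr ?expr0n ?sqr_ge0 // mulr0 subr0.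
by move=> _ _; rewrite integral0.
Qed.

Lemma sqr_add3 (x y z : R) : (x + y + z) ^+ 2 <= 3 * (x ^+ 2 + y ^+ 2 + z ^+ 2).
Proof.
rewrite -subr_ge0 (_ : _ - _ = (x - y) ^+ 2 + (y - z) ^+ 2 + (x - z) ^+ 2); last by ring.
by rewrite !addr_ge0 // sqr_ge0.
Qed.

Lemma avg_bounded s f (M : R) N x : 0 <= M -> (forall x, `|f x| <= M) -> `|avg s f N x| <= M.
Proof.
move=> M0 fM; rewrite /ergodic_average sum_from1 normrM ger0_norm ?invr_ge0 //.
case: N => [|N]; first by rewrite invr0 mul0r.
rewrite ler_pdivrMl ?ltr0n //; apply: (le_trans (ler_norm_sum _ _ _)).
apply: (le_trans (ler_sum _ (fun i _ => fM _))).
by rewrite sumr_const card_ord mulr_natl.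
Qed.

Lemma avg_cvg_L2_bounded s (f : X -> R) (g : X -> R) (M : nat) :
  measurable_fun setT f -> (forall x, `|f x| <= M%:R) -> measurable_fun setT g ->
  {ae mu, forall x, avg s f N x @[N --> \oo] --> g x} ->
  (\int[mu]_x ((avg s f N x - g x) ^+ 2)%:E)%E @[N --> \oo] --> 0%E.
Proof.
move=> mf fM mg fg.
have := @dominated_convergence _ _ R mu setT measurableT
  (fun N x => ((avg s f N x - g x) ^+ 2)%:E) (cst 0%E) (cst ((2 * M%:R) ^+ 2)%:E).
case=> //.
- move=> N; apply/measurable_EFinP; apply: measurable_funX; apply: measurable_funB => //.
  exact: measurable_avg.
- apply: filterS fg => x fg _; apply/cvg_EFin; first exact: nearW.
  rewrite /= (_ : 0 = (g x - g x) * (g x - g x)); last by rewrite subrr mulr0.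
  by apply: cvgM; apply: cvgB => //; exact: cvg_cst.
- exact: finite_measure_integrable_cst.
- apply: filterS fg => x fg N _ /=; rewrite lee_fin ger0_norm ?sqr_ge0 //.
  have gM : `|g x| <= M%:R.
    have /cvg_norm h := fg; rewrite -(cvg_lim (@Rhausdorff R) h).
    apply: limr_le; first by apply/cvg_ex; eexists; exact: h.
    by apply: nearW => n; exact: avg_bounded.
  have aM : `|avg s f N x| <= M%:R by exact: avg_bounded.
  rewrite -[leLHS]real_normK ?num_real // lerXn2r ?nnegrE ?mulr_ge0 //.
  by apply: (le_trans (ler_normB _ _)); rewrite mulr_natl mulr2n lerD.
by move=> _ _; rewrite integral0.
Qed.

(** Dominated convergence handles bounded functions, and truncation reduces
    to them: the averages of the tail are small in mean square uniformly in
    [N] by [int_avg_sq], and so is their limit by Fatou's lemma. The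
    hypothesis on bounded functions gives a limit to the averages of the
    truncation, hence to those of the tail. *)
Lemma avg_cvg_L2 s (f : X -> R) (g : X -> R) :
  (forall (h : X -> R) (M : nat), measurable_fun setT h -> (forall x, `|h x| <= M%:R) ->
     exists2 k : X -> R, measurable_fun setT k &
       {ae mu, forall x, avg s h N x @[N --> \oo] --> k x}) ->
  measurable_fun setT f -> (\int[mu]_x ((f x) ^+ 2)%:E < +oo)%E -> measurable_fun setT g ->
  {ae mu, forall x, avg s f N x @[N --> \oo] --> g x} ->
  (\int[mu]_x ((avg s f N x - g x) ^+ 2)%:E)%E @[N --> \oo] --> 0%E.
Proof.
move=> Hb mf f2 mg fg.
have ge0int (v : X -> R) : (0 <= \int[mu]_x ((v x) ^+ 2)%:E)%E.
  by apply: integral_ge0 => x _; rewrite lee_fin sqr_ge0.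
(* three errors of mean square at most [e / 9], with the factor 3 of
   [sqr_add3] *)
apply/cvge0P => // e e0; have e9 : 0 < e / 9 by rewrite divr_gt0.
have /cvge0P /(_ _ e9) [//|M0 _ /(_ M0 (leqnn _)) /= hM] := int_truncate_cvg mf f2.
set h := truncate M0 f in hM.
have mh : measurable_fun setT h by exact: measurable_truncate.
have mfh : measurable_fun setT (fun x => f x - h x) by exact: measurable_funB.
have [k mk hk] := Hb h M0 mh (truncate_bound M0 f).
have hkL2 := avg_cvg_L2_bounded mh (truncate_bound M0 f) mk hk.
have gk : (\int[mu]_x ((g x - k x) ^+ 2)%:E <= (e / 9)%:E)%E.
  apply: (@fatou_sq (fun N => avg s (fun x => f x - h x) N)).
  - by move=> n; exact: measurable_avg.
  - exact: measurable_funB.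
  - move: fg hk; apply: filterS2 => x fgx hkx.
    under eq_fun do rewrite avgB; exact: cvgB.
  - by move=> n; apply: le_trans hM; exact: int_avg_sq.
have /cvge0P /(_ _ e9) [//|N0 _ hN] := hkL2.
exists N0 => // N /= nN.
have {}hN := hN N nN.
have mA s' f' N' : measurable_fun setT f' -> measurable_fun setT (avg s' f' N') by exact: measurable_avg.
have m2 (v : X -> R) : measurable_fun setT v -> measurable_fun setT (fun x => ((v x) ^+ 2)%:E).
  by move=> mv; apply/measurable_EFinP; exact: measurable_funX.
have t1 := le_trans (int_avg_sq s N mfh) hM.
apply: (@le_trans _ _ (\int[mu]_x (3%:E * (((avg s (fun x => f x - h x) N x) ^+ 2)%:E +
   ((avg s h N x - k x) ^+ 2)%:E + ((g x - k x) ^+ 2)%:E)))%E).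
  apply: ge0_le_integral => //.
  - by move=> x _; rewrite lee_fin sqr_ge0.
  - by apply: m2; apply: measurable_funB => //; exact: mA.
  - apply: measurable_funeM; apply: emeasurable_funD; last by apply: m2; exact: measurable_funB.
    by apply: emeasurable_funD; apply: m2; [exact: mA|apply: measurable_funB => //; exact: mA].
  - move=> x _; rewrite -!EFinD -EFinM lee_fin.
    rewrite (_ : _ - _ = avg s (fun x => f x - h x) N x + (avg s h N x - k x) + (k x - g x)).
      by rewrite -[(g x - k x) ^+ 2]sqrrN opprB; exact: sqr_add3.
    by rewrite avgB; ring.
have mm1 : measurable_fun setT (fun x => ((avg s (fun x => f x - h x) N x) ^+ 2)%:E) by apply: m2; exact: mA.
have mm2 : measurable_fun setT (fun x => ((avg s h N x - k x) ^+ 2)%:E).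
  by apply: m2; apply: measurable_funB => //; exact: mA.
have mm3 : measurable_fun setT (fun x => ((g x - k x) ^+ 2)%:E) by apply: m2; exact: measurable_funB.
have p0 (v : X -> R) x : (0 <= ((v x) ^+ 2)%:E)%E by rewrite lee_fin sqr_ge0.
have m12 := emeasurable_funD mm1 mm2.
have p12 x : setT x -> (0 <= ((avg s (fun x => f x - h x) N x) ^+ 2)%:E + ((avg s h N x - k x) ^+ 2)%:E)%E.
  by move=> _; rewrite adde_ge0 // lee_fin sqr_ge0.
have m123 := emeasurable_funD m12 mm3.
have p123 x : setT x -> (0 <= ((avg s (fun x => f x - h x) N x) ^+ 2)%:E + ((avg s h N x - k x) ^+ 2)%:E + ((g x - k x) ^+ 2)%:E)%E.
  by move=> _; rewrite !adde_ge0 // lee_fin sqr_ge0.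
rewrite ge0_integralZl //.
rewrite ge0_integralD //.
have -> : (\int[mu]_x (((avg s (fun x => f x - h x) N x) ^+ 2)%:E + ((avg s h N x - k x) ^+ 2)%:E) =
   \int[mu]_x ((avg s (fun x => f x - h x) N x) ^+ 2)%:E + \int[mu]_x ((avg s h N x - k x) ^+ 2)%:E)%E.
  by apply: ge0_integralD => // x _; rewrite lee_fin sqr_ge0.
apply: (@le_trans _ _ (3%:E * ((e / 9)%:E + (e / 9)%:E + (e / 9)%:E))%E).
  by rewrite lee_pmul2l ?lte_fin //; apply: leeD => //; apply: leeD.
  by rewrite -!EFinD -EFinM lee_fin; lra.
by move=> x _; rewrite lee_fin sqr_ge0.
Qed.

Lemma sq_integrable_integrable (f : X -> R) : measurable_fun setT f ->
  (\int[mu]_x ((f x) ^+ 2)%:E < +oo)%E -> mu.-integrable setT (EFin \o f).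
Proof.
move=> mf f2.
have If2 : mu.-integrable setT (fun x => ((f x) ^+ 2)%:E).
  apply/integrableP; split; first by apply/measurable_EFinP; exact: measurable_funX.
  by under eq_integral do rewrite /= ger0_norm ?sqr_ge0 //.
have I1 := integrableD measurableT If2 (finite_measure_integrable_cst mu 1 measurableT).
apply: le_integrable I1 => //; first exact/measurable_EFinP.
move=> x _ /=; rewrite lee_fin [X in _ <= X]ger0_norm ?addr_ge0 ?sqr_ge0 //.
rewrite -[f x ^+ 2]real_normK ?num_real //.
by have := normr_ge0 (f x); nra.
Qed.

Lemma avg_id f N x : avg id f N x = N%:R^-1 * birkhoff_sum T f N (T x).
Proof.
rewrite /ergodic_average sum_from1; congr (_ * _); apply: eq_bigr => i _.
by rewrite -iterSr.
Qed.

(** A limsup gives a function measurable on the whole space. The averages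
    here start with the term at [T x], whence the appeal to [ae_mp]. *)
Lemma birkhoff_limit (f : X -> R) : mu.-integrable setT (EFin \o f) ->
  exists2 g : X -> R, measurable_fun setT g &
    {ae mu, forall x, avg id f N x @[N --> \oo] --> g x}.
Proof.
move=> If.
have mf : measurable_fun setT f by apply/measurable_EFinP; case/integrableP : If.
pose g x := fine (limn_esup (fun N => (avg id f N x)%:E)).
exists g.
  apply: (measurableT_comp (@fine_measurable _ _ measurableT)).
  apply: measurable_fun_limn_esup => n; apply/measurable_EFinP; exact: measurable_avg.
have := ae_mp mp (birkhoff mp If); apply: filterS => x.
under eq_fun do rewrite -avg_id.
move=> /cvg_ex[/= l hl].
have hl' : (avg id f N x)%:E @[N --> \oo] --> l%:E by apply/cvg_EFin => //; exact: nearW.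
by rewrite /g (cvg_limn_einf_sup hl').2.
Qed.

Lemma avg_id_T f N x : avg id f N (T x) = N%:R^-1 * (N.+1%:R * avg id f N.+1 x - f (T x)).
Proof.
rewrite !avg_id birkhoff_sumS; congr (_ * _).
by rewrite mulrA mulfV ?pnatr_eq0 // mul1r addrC addKr.
Qed.

Lemma limit_invariant (f g : X -> R) :
  {ae mu, forall x, avg id f N x @[N --> \oo] --> g x} ->
  {ae mu, forall x, g (T x) = g x}.
Proof.
move=> fg; move: fg (ae_mp mp fg); apply: filterS2 => x h1 h2.
apply: (cvg_unique (@Rhausdorff R) h2).
rewrite (_ : (fun N => _) = (fun N => (N%:R^-1 * N.+1%:R) * avg id f N.+1 x - N%:R^-1 * f (T x))); last first.
  by apply/funext => N; rewrite avg_id_T mulrBr mulrA.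
rewrite (_ : g x = 1 * g x - 0 * f (T x)); last by rewrite mul1r mul0r subr0.
have i0 : (n%:R^-1 : R) @[n --> \oo] --> (0 : R).
  by rewrite -(cvg_shiftS (fun n => n%:R^-1 : R)); exact: cvg_harmonic.
apply: cvgB; last by apply: cvgM => //; exact: cvg_cst.
apply: cvgM; last by rewrite (cvg_shiftS (fun n => avg id f n x)).
rewrite -[X in _ --> X]addr0.
have h : (1 + n%:R^-1 : R) @[n --> \oo] --> (1 + 0 : R) by apply: cvgD => //; exact: cvg_cst.
apply: cvg_trans h.
apply: near_eq_cvg; exists 1%N => // n /= n1.
by rewrite -natr1 mulrDr mulr1 mulVf // pnatr_eq0 -lt0n.
Qed.

Lemma invariant_iter (A : set X) n : invariant_sets mu T A ->
  {ae mu, forall x, \1_A (iter n T x) = \1_A x :> R}.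
Proof.
move=> [mA A0].
have mTA : measurable (T @^-1` A) by rewrite -[X in measurable X]setTI; exact: mT.
have h1 : {ae mu, forall x, \1_A (T x) = \1_A x :> R}.
  exists (A `+` T @^-1` A); split=> //.
    by rewrite /setY; apply: measurableU; apply: measurableD.
  move=> x /= nx; apply: contrapT => nA; apply: nx; rewrite !indicE.
  have [xA|xA] := pselect (A x); have [TxA|TxA] := pselect (A (T x)).
  - by rewrite !mem_set.
  - by exfalso; apply: nA; left; split.
  - by exfalso; apply: nA; right; split.
  - by rewrite !memNset.
elim: n => [|n ih]; first exact: aeW.
move: ih (ae_mp (mp_iter n mp) h1); apply: filterS2 => x e1 e2 /=.
by rewrite e2.
Qed.

Lemma integral_avg_invariant s (f : X -> R) (A : set X) N : (0 < N)%N ->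
  mu.-integrable setT (EFin \o f) -> invariant_sets mu T A ->
  \int[mu]_x (avg s f N x * \1_A x) = \int[mu]_x (f x * \1_A x).
Proof.
move=> N0 If iA; have mA := iA.1.
have If1 : mu.-integrable setT (EFin \o (fun x => f x * \1_A x)) by exact: integrable_mul_indic.
have Ii i : mu.-integrable setT (EFin \o (fun x => f (iter i T x) * \1_A x)).
  by apply: integrable_mul_indic => //; exact: (integrable_mp (mp_iter i mp) If).
have Ei i : \int[mu]_x (f (iter i T x) * \1_A x) = \int[mu]_x (f x * \1_A x).
  rewrite -(Rintegral_mp (mp_iter i mp) If1); congr fine; apply: ae_eq_integral => //.
  - by have /integrableP[] := Ii i.
  - by have /integrableP[] := integrable_mp (mp_iter i mp) If1.
  - by apply: filterS (invariant_iter i iA) => x h _; rewrite h.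
have Is M : mu.-integrable setT (EFin \o (fun x => \sum_(i < M) (f (iter (s i.+1) T x) * \1_A x))).
  have := integrable_sum measurableT (index_enum 'I_M) (fun (i : 'I_M) (_ : true) => Ii (s i.+1)).
  by apply: eq_integrable => // x _ /=; rewrite sumEFin.
have -> : \int[mu]_x (avg s f N x * \1_A x) = \int[mu]_x (N%:R^-1 * \sum_(i < N) (f (iter (s i.+1) T x) * \1_A x)).
  by apply: eq_Rintegral => x _; rewrite /ergodic_average sum_from1 -mulrA mulr_suml.
rewrite RintegralZl //.
have -> M : \int[mu]_x (\sum_(i < M) (f (iter (s i.+1) T x) * \1_A x)) = M%:R * \int[mu]_x (f x * \1_A x).
  elim: M => [|M ih].
    by rewrite mul0r; under eq_Rintegral do rewrite big_ord0; rewrite Rintegral_cst // mul0r.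
  under eq_Rintegral do rewrite big_ord_recr.
  by rewrite RintegralD // ih Ei -natr1 mulrDl mul1r.
by rewrite mulrA mulVf ?mul1r // pnatr_eq0 -lt0n.
Qed.

(** The averages have the same integral as [f] over every invariant set, and
    mean-square convergence carries this to the limit. *)
Lemma is_cond_exp_birkhoff (f g : X -> R) : measurable_fun setT f ->
  (\int[mu]_x ((f x) ^+ 2)%:E < +oo)%E -> measurable_fun setT g ->
  {ae mu, forall x, avg id f N x @[N --> \oo] --> g x} ->
  is_cond_exp mu (invariant_sets mu T) f g.
Proof.
move=> mf f2 mg fg.
have If := sq_integrable_integrable mf f2.
have g2 : (\int[mu]_x ((g x) ^+ 2)%:E < +oo)%E.
  apply: (le_lt_trans _ f2); apply: (@fatou_sq (fun N => avg id f N)) => //.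
  - by move=> n; exact: measurable_avg.
  - by move=> n; exact: int_avg_sq.
have Ig := sq_integrable_integrable mg g2.
have L2 : (\int[mu]_x ((avg id f N x - g x) ^+ 2)%:E)%E @[N --> \oo] --> 0%E.
  apply: avg_cvg_L2 => // h M mh hM; apply: birkhoff_limit.
  apply: measurable_bounded_integrable => //.
    by rewrite (le_lt_trans (probability_le1 mu measurableT)) // ltey.
  exists M%:R; split; first exact: num_real.
  by move=> r /ltW Mr z _ /=; exact: le_trans (hM z) Mr.
split=> //.
  move=> B mB; have mgB : measurable (g @^-1` B) by rewrite -[X in measurable X]setTI; exact: mg.
  have mTgB : measurable (T @^-1` (g @^-1` B)) by rewrite -[X in measurable X]setTI; exact: mT.
  split=> //.
  have mD : measurable ((g @^-1` B) `+` (T @^-1` (g @^-1` B))).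
    by rewrite /setY; apply: measurableU; apply: measurableD.
  apply/negligibleP => //; apply: negligibleS (limit_invariant fg).
  by move=> x [[/= h1 h2]|[/= h1 h2]] e; [apply: h2; rewrite e|apply: h2; rewrite -e].
move=> A iA; have mA := iA.1.
have RI (v : X -> R) : mu.-integrable setT (EFin \o v) ->
    (\int[mu]_(x in A) (v x)%:E = (\int[mu]_x (v x * \1_A x))%:E)%E.
  move=> Iv; rewrite /Rintegral fineK; last first.
    by apply: integrable_fin_num => //; exact: integrable_mul_indic.
  rewrite [LHS]integral_mkcond; apply: eq_integral => x _.
  by rewrite restrict_EFin /= /patch indicE; case: (x \in A); rewrite ?mulr1 ?mulr0.
rewrite !RI //; congr EFin.
have Iav N : mu.-integrable setT (EFin \o (avg id f N)).
  apply: sq_integrable_integrable; first exact: measurable_avg.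
  exact: le_lt_trans (int_avg_sq id N mf) f2.
(* as [`|z| <= e / 4 + z ^+ 2 / e], a mean square error of at most [e ^+ 2 /
   4] bounds the mean error by [e / 2] *)
have key (e : R) : 0 < e -> `|\int[mu]_x (g x * \1_A x) - \int[mu]_x (f x * \1_A x)| <= e.
  move=> e0.
  have e4 : 0 < e ^+ 2 / 4 by rewrite divr_gt0 // exprn_gt0.
  have ge0int N : (0 <= \int[mu]_x ((avg id f N x - g x) ^+ 2)%:E)%E.
    by apply: integral_ge0 => x _; rewrite lee_fin sqr_ge0.
  have /cvge0P /(_ _ e4) [//|N0 _ hN] := L2.
  have {}hN := hN N0.+1 (leqnSn _).
  rewrite -(@integral_avg_invariant id f A N0.+1) // -RintegralB //; last 2 first.
  - exact: integrable_mul_indic.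
  - by apply: integrable_mul_indic.
  apply: (le_trans (le_normr_Rintegral _ _)) => //.
    have := integrableB measurableT (integrable_mul_indic mA Ig) (integrable_mul_indic mA (Iav N0.+1)).
    by [].
  have I2 : mu.-integrable setT (EFin \o (fun x => (avg id f N0.+1 x - g x) ^+ 2)).
    apply/integrableP; split.
      apply/measurable_EFinP; apply: measurable_funX; apply: measurable_funB => //.
      exact: measurable_avg.
    under eq_integral do rewrite /= ger0_norm ?sqr_ge0 //.
    exact: le_lt_trans hN (ltey _).
  have I3 : mu.-integrable setT (EFin \o (fun x => e^-1 * (avg id f N0.+1 x - g x) ^+ 2)).
    by have := integrableZl measurableT e^-1 I2.
  have Ie := finite_measure_integrable_cst mu (e / 4) measurableT.
  apply: (@le_trans _ _ (\int[mu]_x (e / 4 + e^-1 * (avg id f N0.+1 x - g x) ^+ 2))).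
    apply: le_Rintegral => //.
    - apply: integrable_norm => //.
      by have := integrableB measurableT (integrable_mul_indic mA Ig) (integrable_mul_indic mA (Iav N0.+1)).
    - by have := integrableD measurableT Ie I3.
    move=> x _; rewrite -mulrBl normrM -normrN opprB.
    set z := avg _ _ _ _ - _.
    apply: (@le_trans _ _ `|z|).
      by rewrite indicE; case: (_ \in _); rewrite ?normr1 ?mulr1 // normr0 mulr0.
    rewrite -[z ^+ 2]real_normK ?num_real //.
    rewrite -subr_ge0 (_ : _ - _ = e^-1 * (`|z| - e / 2) ^+ 2).
      by rewrite mulr_ge0 ?sqr_ge0 // invr_ge0 ltW.
    by field; rewrite gt_eqF.
  have hc : \int[mu]_x (e / 4) = e / 4 by rewrite Rintegral_cst //= probability_setT /= mulr1.
  rewrite RintegralD //.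
  rewrite hc RintegralZl //.
  have : \int[mu]_x (avg id f N0.+1 x - g x) ^+ 2 <= e ^+ 2 / 4.
    by rewrite -lee_fin /Rintegral fineK //; exact: integrable_fin_num.
  move=> h; apply: (@le_trans _ _ (e / 4 + e^-1 * (e ^+ 2 / 4))).
    by rewrite lerD2l ler_wpM2l // invr_ge0 ltW.
  have -> : e / 4 + e^-1 * (e ^+ 2 / 4) = e / 2 by field; rewrite gt_eqF.
  by lra.
apply/eqP; rewrite -subr_eq0 -normr_le0; apply/ler_addgt0Pr => e e0.
by rewrite add0r; exact: key.
Qed.
End averages.
End system.

(** * Deterministic sequences *)

Section sequences.
Variable R : realType.

Lemma sum_mono (F : nat -> R) (n m : nat) : (forall i, 0 <= F i) -> (n <= m)%N ->
  \sum_(i < n) F i <= \sum_(i < m) F i.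
Proof.
move=> F0; elim: m => [|m ih]; first by rewrite leqn0 => /eqP ->.
rewrite leq_eqVlt => /predU1P[->//|/ih h]; rewrite big_ord_recr /=.
by apply: (le_trans h); rewrite lerDl.
Qed.

(** Subtraction being truncated, [(i - j) + (j - i)] is the distance of [i]
    and [j]. Each lag occurs twice except for the lag 0, whence the
    correction. *)
Lemma toeplitz_sum (w kappa : nat -> R) (N : nat) :
  \sum_(i < N) \sum_(j < N) w i * w j * kappa ((i - j) + (j - i))%N =
  2 * (\sum_(h < N) kappa h * \sum_(i < N - h) (w i * w (i + h)%N))
    - kappa 0 * \sum_(i < N) (w i * w i).
Proof.
elim: N => [|N ih]; first by rewrite !big_ord0 !mulr0 subrr.
rewrite big_ord_recr /=.
under eq_bigr do rewrite big_ord_recr /=.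
rewrite big_split /= ih !big_ord_recr /= !subnn addn0.
have -> : \sum_(i < N) w N * w i * kappa (N - i + (i - N))%N =
          \sum_(i < N) w i * w N * kappa (i - N + (N - i))%N.
  by apply: eq_bigr => i _; rewrite addnC (mulrC (w N)).
have -> : \sum_(i < N) w i * w N * kappa (i - N + (N - i))%N =
          \sum_(i < N) kappa i.+1 * (w (N - i.+1)%N * w N).
  rewrite (reindex_inj rev_ord_inj) /=; apply: eq_bigr => i _.
  have iN := ltn_ord i.
  have -> : (N - i.+1 - N)%N = 0%N by lia.
  have -> : (N - (N - i.+1))%N = i.+1 by lia.
  by rewrite add0n mulrC.
have -> : \sum_(h < N) kappa h * (\sum_(i < N.+1 - h) (w i * w (i + h)%N)) =
   \sum_(h < N) kappa h * (\sum_(i < N - h) (w i * w (i + h)%N)) + \sum_(h < N) kappa h * (w (N - h)%N * w N).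
  rewrite -big_split; apply: eq_bigr => h _ /=.
  have hN := ltn_ord h; rewrite (subSn (ltnW hN)) big_ord_recr /= subnK ?(ltnW hN) //.
  by rewrite mulrDr.
have -> : \sum_(i < N.+1 - N) (w i * w (i + N)%N) = w 0 * w N.
  by rewrite subSn // subnn big_ord_recl big_ord0 addr0 add0n.
have e : \sum_(h < N) kappa h * (w (N - h)%N * w N) + kappa N * (w 0 * w N) =
    kappa 0 * (w N * w N) + \sum_(i < N) kappa i.+1 * (w (N - i.+1)%N * w N).
  pose G h := kappa h * (w (N - h)%N * w N).
  have h1 : \sum_(h < N.+1) G h = \sum_(h < N) G h + G N by rewrite big_ord_recr.
  have h2 : \sum_(h < N.+1) G h = G 0 + \sum_(i < N) G i.+1 by rewrite big_ord_recl.
  by move: h1; rewrite h2 /G subn0 subnn => ->.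
lra.
Qed.

(** The correction from the diagonal has the favourable sign. *)
Lemma toeplitz_sum_le (w kappa : nat -> R) (N : nat) (F : R) :
  0 <= kappa 0 -> (forall h, `|kappa h| <= F) ->
  \sum_(i < N) \sum_(j < N) w i * w j * kappa ((i - j) + (j - i))%N <=
  2 * F * \sum_(h < N) `|\sum_(i < N - h) (w i * w (i + h)%N)|.
Proof.
move=> k0 kF; rewrite toeplitz_sum lerBlDr.
apply: (@le_trans _ _ (2 * F * \sum_(h < N) `|\sum_(i < N - h) (w i * w (i + h)%N)|)); last first.
  by rewrite lerDl mulr_ge0 // sumr_ge0 // => i _; rewrite -expr2 sqr_ge0.
rewrite -mulrA ler_wpM2l // mulr_sumr; apply: ler_sum => h _.
by apply: (le_trans (ler_norm _)); rewrite normrM ler_wpM2r.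
Qed.

Lemma cvg0_bounded_sums (v : nat -> R) (C : R) : (forall k, 0 <= v k) ->
  (forall K, \sum_(k < K) v k <= C) -> v k @[k --> \oo] --> 0.
Proof.
move=> v0 vC; apply: cvg_series_cvg_0; apply: nondecreasing_is_cvgn.
  apply/nondecreasing_seqP => n; rewrite /series /= big_nat_recr //=.
  by rewrite lerDl.
exists C => _ [n _ <-]; rewrite /series /= big_mkord; exact: vC.
Qed.

Lemma abel_sum (p x : nat -> R) (N : nat) :
  \sum_(i < N) p i * x i =
  p N * \sum_(j < N) x j + \sum_(i < N) (p i - p i.+1) * \sum_(j < i.+1) x j.
Proof.
elim: N => [|N ih]; first by rewrite !big_ord0 mulr0 addr0.
rewrite big_ord_recr /= ih [X in p N.+1 * X]big_ord_recr [X in _ = _ + X]big_ord_recr /=.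
by rewrite [X in _ = _ + (_ + _ * X)]big_ord_recr /=; ring.
Qed.

(** Summation by parts writes the weighted sum as a combination of
    unweighted partial sums with nonnegative coefficients, so an affine
    bound on the latter suffices. *)
Lemma weighted_cvg (p x : nat -> R) (L : R) : (forall i, 0 <= p i.+1 <= p i) ->
  \sum_(i < N) p i @[N --> \oo] --> +oo ->
  N%:R^-1 * \sum_(i < N) x i @[N --> \oo] --> L ->
  (\sum_(i < N) p i)^-1 * \sum_(i < N) p i * x i @[N --> \oo] --> L.
Proof.
move=> pd poo xL; apply/cvgrPdist_le => e e0.
have e2 : 0 < e / 2 by rewrite divr_gt0.
have p0 i : 0 <= p i by case: i => [|i]; have /andP[h1 h2] := pd 0; [exact: le_trans h2|have /andP[] := pd i].
pose S n := \sum_(j < n) (x j - L).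
have [K hK] : exists K : R, forall n, `|S n| <= e / 2 * n%:R + K.
  move/cvgrPdist_le : xL => /(_ _ e2) [N0 _ hN].
  exists (\sum_(j < N0) `|x j - L|) => n.
  have K0 m : 0 <= \sum_(j < m) `|x j - L| by apply: sumr_ge0.
  have [nN|Nn] := leqP N0 n; last first.
    apply: (le_trans (ler_norm_sum _ _ _)).
    apply: (@le_trans _ _ (\sum_(j < N0) `|x j - L|)); last by rewrite lerDr mulr_ge0 // ltW.
    exact: (sum_mono (fun j => normr_ge0 (x j - L)) (ltnW Nn)).
  case: n nN => [|n] nN; first by rewrite /S big_ord0 normr0 mulr0 add0r.
  have := hN n.+1 nN; set n1 : R := n.+1%:R; have n0 : 0 < n1 by rewrite ltr0n.
  have -> : S n.+1 = - (n1 * (L - n1^-1 * \sum_(i < n.+1) x i)).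
    rewrite /S sumrB sumr_const card_ord -[L *+ _]mulr_natr -/n1.
    by field; rewrite gt_eqF.
  rewrite normrN normrM (ger0_norm (ltW n0)) => h.
  by rewrite -[leLHS]addr0 lerD // mulrC ler_wpM2r // ltW.
have bound N : `|\sum_(i < N) p i * (x i - L)| <= e / 2 * \sum_(i < N) p i + K * p 0.
  rewrite (abel_sum p (fun j => x j - L)) -/(S N).
  (* summation by parts for the sequences [1, 1, 1, ...] and [1, 0, 0, ...],
     whose partial sums are the two parts [n] and 1 of the affine bound *)
  have one : \sum_(i < N) p i = p N * N%:R + \sum_(i < N) (p i - p i.+1) * i.+1%:R.
    elim: (N) => [|m ihm]; first by rewrite !big_ord0 mulr0 addr0.
    by rewrite !big_ord_recr /= ihm -natr1; ring.
  have tele : p 0 = p N + \sum_(i < N) (p i - p i.+1).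
    elim: (N) => [|m ihm]; first by rewrite big_ord0 addr0.
    by rewrite big_ord_recr /= ihm; ring.
  have -> : e / 2 * \sum_(i < N) p i + K * p 0 =
    p N * (e / 2 * N%:R + K) + \sum_(i < N) (p i - p i.+1) * (e / 2 * i.+1%:R + K).
    rewrite one tele.
    have -> : \sum_(i < N) (p i - p i.+1) * (e / 2 * i.+1%:R + K) =
        e / 2 * (\sum_(i < N) (p i - p i.+1) * i.+1%:R) + K * \sum_(i < N) (p i - p i.+1).
      by rewrite !mulr_sumr -big_split; apply: eq_bigr => i _ /=; ring.
    by ring.
  apply: (le_trans (ler_normD _ _)); apply: lerD.
    by rewrite normrM (ger0_norm (p0 N)) ler_wpM2l.
  apply: (le_trans (ler_norm_sum _ _ _)); apply: ler_sum => i _.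
  have /andP[_ pi] := pd i.
  have d0 : 0 <= p i - p i.+1 by rewrite subr_ge0.
  by rewrite normrM (ger0_norm d0) (ler_wpM2l d0) //; exact: (hK i.+1).
have /cvgryPge /(_ (K * p 0 / (e / 2) + 1)) P1 := poo.
have /cvgryPge /(_ 1) P2 := poo.
move: P1 P2; apply: filterS2 => N P1 P2.
set P := \sum_(i < N) p i in P1 P2 *.
have P0 : 0 < P by rewrite (lt_le_trans ltr01).
have -> : L - P^-1 * \sum_(i < N) p i * x i = - (P^-1 * \sum_(i < N) p i * (x i - L)).
  under [in RHS]eq_bigr do rewrite mulrBr.
  by rewrite sumrB -mulr_suml -/P; field; rewrite gt_eqF.
rewrite normrN normrM ger0_norm ?invr_ge0 ?(ltW P0) // ler_pdivrMl //.
apply: (le_trans (bound N)); rewrite -/P.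
have : K * p 0 <= e / 2 * P.
  rewrite [leRHS]mulrC -ler_pdivrMr //; apply: le_trans P1; by rewrite lerDl.
by lra.
Qed.

(** Between consecutive times [n_ k] and [n_ k.+1] the ratio is squeezed, by
    monotonicity, between two ratios that differ from those at these times
    by a factor tending to 1. *)
Lemma interpolate_cvg (Y P : nat -> R) (n_ : nat -> nat) (L : R) :
  (forall N M, (N <= M)%N -> Y N <= Y M) -> (forall N, 0 <= Y N) ->
  (forall N M, (N <= M)%N -> P N <= P M) -> (forall k, 0 < P (n_ k)) ->
  (forall k, (k < n_ k)%N) ->
  Y (n_ k) / P (n_ k) @[k --> \oo] --> L ->
  P (n_ k.+1) / P (n_ k) @[k --> \oo] --> (1 : R) ->
  Y N / P N @[N --> \oo] --> L.
Proof.
move=> Ym Y0 Pm P0 nk YL P1.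
have YL1 : Y (n_ k.+1) / P (n_ k.+1) @[k --> \oo] --> L.
  by rewrite (cvg_shiftS (fun k => Y (n_ k) / P (n_ k))).
have up : Y (n_ k.+1) / P (n_ k) @[k --> \oo] --> L.
  rewrite -[L]mulr1; rewrite (_ : (fun k => _) =
     (fun k => (Y (n_ k.+1) / P (n_ k.+1)) * (P (n_ k.+1) / P (n_ k)))); first exact: cvgM.
  by apply/funext => k; field; rewrite !gt_eqF.
have lo : Y (n_ k) / P (n_ k.+1) @[k --> \oo] --> L.
  rewrite -[L]mulr1 -[X in _ * X]invr1; rewrite (_ : (fun k => _) =
     (fun k => (Y (n_ k) / P (n_ k)) * (P (n_ k.+1) / P (n_ k))^-1)).
    by apply: cvgM => //; apply: cvgV => //; rewrite oner_eq0.
  by apply/funext => k; field; rewrite !gt_eqF.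
apply/cvgrPdist_le => e e0.
have /cvgrPdist_le /(_ e e0) [k1 _ h1] := up; have /cvgrPdist_le /(_ e e0) [k2 _ h2] := lo.
pose k0 := maxn k1 k2.
exists (n_ k0) => // N /= kN.
have exk : exists k, (k0 <= k)%N && (N < n_ k.+1)%N.
  exists (maxn k0 N); rewrite leq_maxl /=.
  by rewrite (leq_ltn_trans _ (nk _)) // (leq_trans (leq_maxr k0 N)).
have [k /andP[kk0 Nk] mink] := ex_minnP exk.
have nkN : (n_ k <= N)%N.
  rewrite leqNgt; apply/negP => Nnk; case: k kk0 Nk mink Nnk => [|k] kk0 Nk mink Nnk.
    by move: kk0 kN; rewrite leqn0 => /eqP ->; rewrite leqNgt Nnk.
  have [e1|e1] := eqVneq k0 k.+1; first by move: kN; rewrite e1 leqNgt Nnk.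
  have : (k.+1 <= k)%N by apply: mink; rewrite Nnk andbT -ltnS ltn_neqAle e1.
  by rewrite ltnn.
have {}h1 := h1 k (leq_trans (leq_maxl _ _) kk0).
have {}h2 := h2 k (leq_trans (leq_maxr _ _) kk0).
have PN : 0 < P N by exact: lt_le_trans (P0 k) (Pm _ _ nkN).
have b1 : Y N / P N <= Y (n_ k.+1) / P (n_ k).
  by rewrite ler_pM ?invr_ge0 ?(ltW PN) ?Ym ?(ltnW Nk) // lef_pV2 ?posrE ?P0 // Pm.
have b2 : Y (n_ k) / P (n_ k.+1) <= Y N / P N.
  by rewrite ler_pM ?invr_ge0 ?(ltW (P0 _)) ?Ym // lef_pV2 ?posrE ?P0 // Pm // ltnW.
move: h1 h2; rewrite /= !ler_norml => /andP[? ?] /andP[? ?].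
by apply/andP; split; lra.
Qed.

End sequences.

(** * Enumeration of the hits *)

Section enumeration.
Variable hitb : nat -> bool.
Definition hit_count (N : nat) : nat := \sum_(i < N) hitb i.
Hypothesis unbounded : forall M, exists N, (M <= hit_count N)%N.

(** The least [N] with [M] hits among the indices below [N]. As index [i]
    stands for rank [i + 1], this number is the rank of the [M]-th hit, and
    the corresponding index is its predecessor. *)
Definition hit_enum (M : nat) : nat := ex_minn (unbounded M).

Lemma hit_countS N : hit_count N.+1 = (hit_count N + hitb N)%N.
Proof. by rewrite /hit_count big_ord_recr. Qed.

Lemma hit_count_mono N M : (N <= M)%N -> (hit_count N <= hit_count M)%N.
Proof.
elim: M => [|M ih]; first by rewrite leqn0 => /eqP ->.
by rewrite leq_eqVlt => /predU1P[->//|/ih h]; rewrite hit_countS (leq_trans h) // leq_addr.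
Qed.

Lemma hit_enum_ge M : (M <= hit_count (hit_enum M))%N.
Proof. by rewrite /hit_enum; case: ex_minnP. Qed.

Lemma hit_enum_min M N : (M <= hit_count N)%N -> (hit_enum M <= N)%N.
Proof. by rewrite /hit_enum; case: ex_minnP => m _ h /h. Qed.

Lemma hit_count0 : hit_count 0 = 0%N. Proof. by rewrite /hit_count big_ord0. Qed.

Lemma hit_enum0 : hit_enum 0 = 0%N.
Proof. by apply/eqP; rewrite -leqn0; apply: hit_enum_min. Qed.

Lemma hit_enumS_pos M : (0 < hit_enum M.+1)%N.
Proof.
have := hit_enum_ge M.+1; case: (hit_enum M.+1) => //; by rewrite hit_count0.
Qed.

Lemma hit_enum_pred M : (hit_count (hit_enum M.+1).-1 <= M)%N.
Proof.
rewrite leqNgt; apply/negP => /hit_enum_min; have := hit_enumS_pos M.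
by case: (hit_enum M.+1) => //= n _; rewrite ltnn.
Qed.

Lemma hit_count_hit_enum M : hit_count (hit_enum M) = M.
Proof.
case: M => [|M]; first by rewrite hit_enum0 hit_count0.
apply/eqP; rewrite eqn_leq hit_enum_ge andbT.
have := hit_enum_pred M; have := hit_enumS_pos M; case: (hit_enum M.+1) => //= n _ h.
by rewrite hit_countS; case: (hitb n) => /=; lia.
Qed.

Lemma hit_hit_enum M : hitb (hit_enum M.+1).-1.
Proof.
have := hit_count_hit_enum M.+1; have := hit_enum_pred M; have := hit_enumS_pos M.
case: (hit_enum M.+1) => //= n _ h; rewrite hit_countS.
by case: (hitb n) => //=; lia.
Qed.

Lemma hit_enum_lt M : (hit_enum M < hit_enum M.+1)%N.
Proof.
rewrite ltnNge; apply/negP => /hit_count_mono; rewrite !hit_count_hit_enum; by rewrite ltnn.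
Qed.

Lemma hit_enum_ge_id M : (M <= hit_enum M)%N.
Proof. by elim: M => // M ih; exact: leq_ltn_trans ih (hit_enum_lt M). Qed.

Lemma hit_enum_hit i : hitb i -> hit_enum (hit_count i.+1) = i.+1.
Proof.
move=> hi; apply/eqP; rewrite eqn_leq hit_enum_min //=.
rewrite ltnNge; apply/negP => /hit_count_mono; rewrite hit_count_hit_enum hit_countS hi /=; lia.
Qed.

Lemma sum_hits (R : realType) (F : nat -> R) M :
  \sum_(i < hit_enum M) (hitb i)%:R * F i = \sum_(n < M) F (hit_enum n.+1).-1.
Proof.
elim: M => [|M ih]; first by rewrite hit_enum0 !big_ord0.
rewrite big_ord_recr /= -ih.
have := hit_enum_lt M; have h1 := hit_hit_enum M; have h2 := hit_enum_pred M.
case: (hit_enum M.+1) h1 h2 => //= n h1 h2; rewrite ltnS => leM.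
rewrite big_ord_recr /= h1 mul1r; congr (_ + _).
rewrite -(subnKC leM) big_split_ord /= [X in _ + X]big1 ?addr0 // => i _.
case hi : (hitb _); last by rewrite mul0r.
have : (hit_count (hit_enum M + i).+1 <= hit_count n)%N.
  by apply: hit_count_mono; have := ltn_ord i; lia.
rewrite hit_countS hi addn1 => h3.
have : (hit_count (hit_enum M) <= hit_count (hit_enum M + i))%N by apply: hit_count_mono; rewrite leq_addr.
by rewrite hit_count_hit_enum; lia.
Qed.

End enumeration.

(** * Weighted sums along an orbit *)

Section borel_cantelli.
Context (R : realType) (d : measure_display) (X : measurableType d).

(** By monotone convergence the sum of the series has a finite integral,
    hence is finite almost everywhere. *)
Lemma ae_bounded_sums (mu : {measure set X -> \bar R}) (D : set X) (v : nat -> X -> R) (C : R) :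
  measurable D -> (forall k, measurable_fun D (v k)) -> (forall k x, D x -> 0 <= v k x) ->
  (forall K : nat, \sum_(k < K) \int[mu]_(x in D) (v k x)%:E <= C%:E)%E ->
  {ae mu, forall x, D x -> exists B : R, forall K : nat, \sum_(k < K) v k x <= B}.
Proof.
move=> mD mv v0 vC.
have mev k : measurable_fun D (fun x => (v k x)%:E) by exact/measurable_EFinP.
have ev0 k x : D x -> (0 <= (v k x)%:E)%E by move=> Dx; rewrite lee_fin v0.
have iv0 k : (0 <= \int[mu]_(x in D) (v k x)%:E)%E by apply: integral_ge0 => x; exact: ev0.
pose s x := (\sum_(0 <= k <oo) (v k x)%:E)%E.
have ms : measurable_fun D s.
  by apply: ge0_emeasurable_sum => // k x Dx _; exact: ev0.
have s0 x : D x -> (0 <= s x)%E by move=> Dx; apply: nneseries_ge0 => k _ _; exact: ev0.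
have Is : mu.-integrable D s.
  apply/integrableP; split=> //.
  have -> : (\int[mu]_(x in D) `|s x| = \int[mu]_(x in D) s x)%E.
    by apply: eq_integral => x /set_mem Dx; rewrite gee0_abs ?s0.
  rewrite integral_nneseries //.
  apply: (@le_lt_trans _ _ C%:E); last exact: ltey.
  apply: lime_le; first by apply: is_cvg_nneseries => k _ _.
  by apply: nearW => K; rewrite big_mkord; exact: vC.
have := integrable_ae mD Is; apply: filterS => x h Dx.
have {}h := h Dx; exists (fine (s x)) => K.
rewrite -lee_fin fineK // -sumEFin -(big_mkord xpredT (fun k => (v k x)%:E)).
by apply: nneseries_lim_ge => k _ _; exact: ev0.
Qed.

End borel_cantelli.

Section correlation.
Context (R : realType) (d : measure_display) (X : measurableType d).
Variables (mu : probability X R) (T : X -> X).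
Hypothesis mp : measure_preserving mu T.
Let mT : measurable_fun setT T := mp.1.

Definition sqint (f : X -> R) := measurable_fun setT f /\ (\int[mu]_x ((f x) ^+ 2)%:E < +oo)%E.

Lemma sqint_iter f n : sqint f -> sqint (fun x => f (iter n T x)).
Proof.
move=> [mf f2]; split; first exact: (measurableT_comp mf (measurable_iterT n mT)).
rewrite (@ge0_integral_mp _ _ _ _ _ (mp_iter n mp) (fun x => ((f x) ^+ 2)%:E)) //.
- by apply/measurable_EFinP; exact: measurable_funX.
- by move=> x; rewrite lee_fin sqr_ge0.
Qed.

Lemma integrable_sq f : sqint f -> mu.-integrable setT (EFin \o (fun x => f x ^+ 2)).
Proof.
move=> [mf f2]; apply/integrableP; split; first by apply/measurable_EFinP; exact: measurable_funX.
by under eq_integral do rewrite /= ger0_norm ?sqr_ge0 //.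
Qed.

Lemma norm_mul_le (x y : R) : `|x * y| <= 2^-1 * (x ^+ 2 + y ^+ 2).
Proof.
rewrite normrM -[x ^+ 2]real_normK ?num_real // -[y ^+ 2]real_normK ?num_real //.
rewrite -subr_ge0 (_ : _ - _ = (`|x| - `|y|) ^+ 2 / 2); last by field.
by rewrite divr_ge0 // sqr_ge0.
Qed.

Lemma integrable_half_sq f g : sqint f -> sqint g ->
  mu.-integrable setT (EFin \o (fun x => 2^-1 * (f x ^+ 2 + g x ^+ 2))).
Proof.
move=> sf sg.
have h : mu.-integrable setT (EFin \o (fun x => f x ^+ 2 + g x ^+ 2)).
  by have := integrableD measurableT (integrable_sq sf) (integrable_sq sg).
by have := integrableZl measurableT 2^-1 h.
Qed.

Lemma integrable_mul f g : sqint f -> sqint g -> mu.-integrable setT (EFin \o (fun x => f x * g x)).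
Proof.
move=> sf sg; apply: le_integrable (integrable_half_sq sf sg) => //.
  by apply/measurable_EFinP; apply: measurable_funM; [exact: sf.1|exact: sg.1].
move=> x _ /=; rewrite lee_fin [leRHS]ger0_norm ?mulr_ge0 ?addr_ge0 ?sqr_ge0 //.
exact: norm_mul_le.
Qed.

Lemma integrable_lincomb (J : Type) (s : seq J) (c : J -> R) (F : J -> X -> R) :
  (forall j, mu.-integrable setT (EFin \o F j)) ->
  mu.-integrable setT (EFin \o (fun x => \sum_(j <- s) c j * F j x)) /\
  \int[mu]_x (\sum_(j <- s) c j * F j x) = \sum_(j <- s) c j * \int[mu]_x F j x.
Proof.
move=> iF; elim: s => [|j s [ih1 ih2]].
  rewrite (_ : (fun x => _) = cst 0); last by apply/funext => x; rewrite big_nil.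
  split; first exact: finite_measure_integrable_cst.
  by rewrite big_nil Rintegral_cst // mul0r.
rewrite (_ : (fun x => _) = (fun x => c j * F j x + \sum_(j <- s) c j * F j x)); last first.
  by apply/funext => x; rewrite big_cons.
have ic : mu.-integrable setT (EFin \o (fun x => c j * F j x)).
  by have := integrableZl measurableT (c j) (iF j).
split; first by have := integrableD measurableT ic ih1.
by rewrite RintegralD // RintegralZl // ih2 big_cons.
Qed.

(** The integral of [f (T^i x) * f (T^j x)] depends only on the distance of
    [i] and [j], and never exceeds that of the square of [f]. The bound thus
    separates the weights from the system. *)
Lemma int_weighted_sq (f : X -> R) (w : nat -> R) (N : nat) : sqint f ->
  (\int[mu]_x ((\sum_(i < N) w i * f (iter i.+1 T x)) ^+ 2)%:E <=
   (2 * (\int[mu]_x f x ^+ 2) * \sum_(h < N) `|\sum_(i < N - h) (w i * w (i + h)%N)|)%:E)%E.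
Proof.
move=> sf.
pose kappa h := \int[mu]_x (f x * f (iter h T x)).
have int2 h : mu.-integrable setT (EFin \o (fun x => f x * f (iter h T x))).
  by apply: integrable_mul => //; exact: sqint_iter.
have kE i j : \int[mu]_x (f (iter i.+1 T x) * f (iter j.+1 T x)) = kappa ((i - j) + (j - i))%N.
  wlog ij : i j / (i <= j)%N.
    move=> wl; have [ij|ij] := leqP i j; first exact: wl.
    rewrite addnC -wl ?(ltnW ij) //.
    by apply: eq_Rintegral => x _; rewrite mulrC.
  have -> : (i - j + (j - i))%N = (j - i)%N by lia.
  rewrite /kappa -(Rintegral_mp (mp_iter i.+1 mp) (int2 (j - i)%N)).
  by apply: eq_Rintegral => x _; rewrite -iterD addnS subnK.
have i2 i j : mu.-integrable setT (EFin \o (fun x => f (iter i.+1 T x) * f (iter j.+1 T x))).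
  by apply: integrable_mul; exact: sqint_iter.
have k0 : kappa 0 = \int[mu]_x f x ^+ 2 by apply: eq_Rintegral => x _.
have kle h : `|kappa h| <= \int[mu]_x f x ^+ 2.
  have sfh := sqint_iter h sf.
  apply: (le_trans (le_normr_Rintegral _ _)) => //.
  apply: (@le_trans _ _ (\int[mu]_x (2^-1 * (f x ^+ 2 + f (iter h T x) ^+ 2)))).
    apply: le_Rintegral => //; [exact: integrable_norm|exact: integrable_half_sq|].
    by move=> x _; exact: norm_mul_le.
  rewrite RintegralZl //; last first.
    by have := integrableD measurableT (integrable_sq sf) (integrable_sq sfh).
  rewrite RintegralD //; [|exact: integrable_sq|exact: integrable_sq].
  rewrite (Rintegral_mp (mp_iter h mp) (integrable_sq sf)).
  by set I0 := (\int[mu]_x f x ^+ 2); lra.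
have sqE : (fun x => (\sum_(i < N) w i * f (iter i.+1 T x)) ^+ 2) =
   (fun x => \sum_(i < N) 1 * (\sum_(j < N) (w i * w j) * (f (iter i.+1 T x) * f (iter j.+1 T x)))).
  apply/funext => x; rewrite expr2 big_distrlr /=; apply: eq_bigr => i _.
  by rewrite mul1r; apply: eq_bigr => j _; ring.
have I1 (i : 'I_N) := @integrable_lincomb _ (index_enum 'I_N) (fun j : 'I_N => w i * w j)
   (fun j : 'I_N => fun x => f (iter i.+1 T x) * f (iter j.+1 T x)) (fun j => i2 i j).
have [I2 I2E] := @integrable_lincomb _ (index_enum 'I_N) (fun i : 'I_N => 1)
   (fun i : 'I_N => fun x => \sum_(j < N) (w i * w j) * (f (iter i.+1 T x) * f (iter j.+1 T x)))
   (fun i => (I1 i).1).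
apply: (@le_trans _ _ (\int[mu]_x ((\sum_(i < N) w i * f (iter i.+1 T x)) ^+ 2))%:E).
  by rewrite /Rintegral fineK //; apply: integrable_fin_num => //; rewrite -/(comp _ _) sqE.
rewrite lee_fin sqE I2E.
apply: le_trans (toeplitz_sum_le w N _ kle); last by rewrite k0 Rintegral_ge0 // => x _; exact: sqr_ge0.
apply: ler_sum => i _; rewrite mul1r (I1 i).2; apply: ler_sum => j _.
by rewrite kE.
Qed.

End correlation.

(** * Sums of densities along sparse times *)

Section subsequence.
Variables (R : realType) (a : R).
Hypotheses (a_gt0 : 0 < a) (a_lt1 : a < 1).
Local Notation p := (@density R a).

Definition density_sum (N : nat) : R := \sum_(i < N) p i.

Lemma density_sum_ge (N : nat) : N%:R `^ (1 - a) <= density_sum N.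
Proof.
case: N => [|N]; first by rewrite /density_sum big_ord0 powR0 // gt_eqF // subr_gt0.
apply: (@le_trans _ _ (\sum_(i < N.+1) p N)).
  rewrite sumr_const card_ord /density powRD ?pnatr_eq0 ?implybT // powRr1 // mulrC.
  by rewrite mulr_natr.
by apply: ler_sum => i _; apply: density_le => //; rewrite -ltnS.
Qed.

Lemma density_sum_gt0 (N : nat) : (0 < N)%N -> 0 < density_sum N.
Proof. by move=> N0; apply: lt_le_trans (density_sum_ge N); rewrite powR_gt0 // ltr0n. Qed.

Lemma density_sum_mono N M : (N <= M)%N -> density_sum N <= density_sum M.
Proof. by apply: sum_mono => i; rewrite ltW // density_gt0. Qed.

Lemma density_sum_cvg : density_sum N @[N --> \oo] --> +oo.
Proof.
have s0 : 0 < 1 - a by rewrite subr_gt0.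
apply/cvgryPge => M; pose M' := `|M| + 1.
have M0 : 0 < M' by rewrite ltr_wpDl.
exists (Num.truncn (M' `^ (1 - a)^-1)).+1 => // N /= hN.
apply: le_trans (density_sum_ge N); apply: (@le_trans _ _ M').
  by rewrite /M' (le_trans (ler_norm M)) // lerDl.
have e : M' = (M' `^ (1 - a)^-1) `^ (1 - a).
  by rewrite -powRrM mulVf ?lt0r_neq0 // powRr1 // ltW.
rewrite [leLHS]e ge0_ler_powR ?nnegrE ?(ltW s0) ?powR_ge0 //.
by rewrite ltW // (lt_le_trans (truncnS_gt _)) // ler_nat.
Qed.

(** Compares the growth of [density_sum] between two times with that of the
    times themselves; the averages of a nonincreasing sequence do not
    increase. *)
Lemma density_sum_ratio N M : (N <= M)%N -> N%:R * density_sum M <= M%:R * density_sum N.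
Proof.
elim: M => [|M ih]; first by rewrite leqn0 => /eqP ->.
rewrite leq_eqVlt => /predU1P[->//|NM].
have {}ih := ih NM; rewrite {1}/density_sum big_ord_recr /= -/(density_sum M) -natr1 mulrDr mulrDl mul1r lerD //.
apply: (@le_trans _ _ (\sum_(i < N) p M)).
  by rewrite sumr_const card_ord mulr_natl.
by apply: ler_sum => i _; apply: density_le => //; rewrite ltnW // (leq_trans (ltn_ord i)).
Qed.

(** Sparse enough for a power saving in the mean values to become summable
    when [m] is large, while the ratio of consecutive times still tends to
    1. *)
Definition sparse_time (m k : nat) : nat := (k.+1 ^ m)%N.

Lemma sparse_time_gt0 m k : (0 < sparse_time m k)%N. Proof. by rewrite expn_gt0. Qed.

Lemma sparse_time_gt m k : (0 < m)%N -> (k < sparse_time m k)%N.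
Proof. by case: m => // m _; rewrite /sparse_time expnS leq_pmulr // expn_gt0. Qed.

Lemma sparse_time_ratio m : (sparse_time m k.+1)%:R / (sparse_time m k)%:R @[k --> \oo] --> (1 : R).
Proof.
have h0 : (1 + k.+1%:R^-1 : R) @[k --> \oo] --> (1 : R).
  rewrite -[X in _ --> X]addr0; apply: cvgD; [exact: cvg_cst|exact: cvg_harmonic].
have -> : (fun k => (sparse_time m k.+1)%:R / (sparse_time m k)%:R : R) = (fun k => (1 + k.+1%:R^-1) ^+ m).
  apply/funext => k; rewrite /sparse_time !natrX -expr_div_n; congr (_ ^+ _).
  by rewrite -[k.+2%:R]natr1 mulrDl mulfV ?pnatr_eq0 // mul1r.
suff : (1 + k.+1%:R^-1) ^+ m @[k --> \oo] --> (1 : R) ^+ m by rewrite expr1n.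
elim: m => [|m ih].
  by under eq_fun do rewrite expr0; exact: cvg_cst.
by under eq_fun do rewrite exprS; rewrite exprS; exact: cvgM.
Qed.

Lemma density_sum_sparse_ratio m :
  density_sum (sparse_time m k.+1) / density_sum (sparse_time m k) @[k --> \oo] --> (1 : R).
Proof.
apply: (squeeze_cvgr _ (cvg_cst (1 : R)) (sparse_time_ratio m)).
apply: nearW => k; have s0 := density_sum_gt0 (sparse_time_gt0 m k).
have kk : (sparse_time m k <= sparse_time m k.+1)%N by rewrite /sparse_time; case: (m) => // m'; rewrite leq_exp2r.
rewrite ler_pdivlMr // mul1r density_sum_mono //= ler_pdivrMr // mulrAC ler_pdivlMr ?ltr0n ?sparse_time_gt0 //.
by rewrite mulrC density_sum_ratio.
Qed.

Lemma sum_inv_sq K : \sum_(k < K) (k.+1%:R ^- 2 : R) <= 2.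
Proof.
case: K => [|K]; first by rewrite big_ord0.
suff H : \sum_(k < K.+1) (k.+1%:R ^- 2 : R) <= 2 - K.+1%:R^-1.
  by apply: (le_trans H); rewrite lerBlDr lerDl invr_ge0.
elim: K => [|K ih]; first by rewrite big_ord_recl big_ord0 expr1n !invr1; lra.
rewrite big_ord_recr /=; apply: (le_trans (lerD ih (lexx _))).
rewrite -[K.+2%:R]natr1; set x : R := K.+1%:R; have x0 : 0 < x by rewrite ltr0n.
rewrite -subr_ge0 (_ : _ - _ = (x * (x + 1) ^+ 2)^-1); first by rewrite invr_ge0 mulr_ge0 ?sqr_ge0 // ltW.
by field; rewrite !gt_eqF // addr_gt0.
Qed.

End subsequence.

(** * Averages along the hitting times *)

Section deterministic.
Variables (R : realType) (a : R) (hitb : nat -> bool) (m : nat) (B : R).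
Hypotheses (a_gt0 : 0 < a) (a_lt1 : a < 1) (m_gt0 : (0 < m)%N).
Local Notation p := (@density R a).
Local Notation P := (@density_sum R a).
Local Notation nk := (sparse_time m).

Definition dev_seq (i : nat) : R := (hitb i)%:R - p i.
Definition autocov_seq (N : nat) : R :=
  \sum_(h < N) `|\sum_(i < N - h) (dev_seq i * dev_seq (i + h)%N)|.

(** What the argument asks of the pattern of hits; no dynamical system
    occurs in it. *)
Hypothesis summable : forall K, \sum_(k < K) autocov_seq (nk k) / P (nk k) ^+ 2 <= B.

Lemma P_gt0 k : 0 < P (nk k). Proof. by apply: density_sum_gt0 => //; exact: sparse_time_gt0. Qed.

Lemma cvg0_of_sqr (v : nat -> R) : (v k) ^+ 2 @[k --> \oo] --> 0 -> v k @[k --> \oo] --> 0.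
Proof.
move=> /cvgrPdist_le h; apply/cvgrPdist_le => e e0.
have e2 : 0 < e ^+ 2 by rewrite exprn_gt0.
apply: filterS (h _ e2) => k /=; rewrite !sub0r !normrN normrX => hk.
by rewrite -(@ler_pXn2r _ 2) ?nnegrE // ltW.
Qed.

(** The case [kappa = 1] of [toeplitz_sum_le], which corresponds to a
    constant function on a trivial system. *)
Lemma dev_seq_sums : (\sum_(i < nk k) dev_seq i) / P (nk k) @[k --> \oo] --> 0.
Proof.
apply: cvg0_of_sqr; apply: (@cvg0_bounded_sums _ _ (2 * B)) => [k|K]; first exact: sqr_ge0.
apply: (@le_trans _ _ (2 * \sum_(k < K) autocov_seq (nk k) / P (nk k) ^+ 2)); last by rewrite ler_wpM2l.
rewrite mulr_sumr; apply: ler_sum => k _.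
rewrite expr_div_n mulrA ler_wpM2r ?invr_ge0 ?sqr_ge0 //.
have := @toeplitz_sum_le _ dev_seq (fun=> 1) (nk k) 1 ler01; rewrite normr1 => /(_ (fun=> lexx _)).
rewrite mulr1; apply: le_trans; rewrite expr2 big_distrlr /=.
by apply: ler_sum => i _; apply: ler_sum => j _; rewrite mulr1.
Qed.

Lemma sum_hit_split N (F : nat -> R) :
  \sum_(i < N) (hitb i)%:R * F i = \sum_(i < N) dev_seq i * F i + \sum_(i < N) p i * F i.
Proof. by rewrite -big_split; apply: eq_bigr => i _ /=; rewrite /dev_seq; ring. Qed.

Lemma hit_count_ratio : (hit_count hitb N)%:R / P N @[N --> \oo] --> (1 : R).
Proof.
apply: (@interpolate_cvg _ (fun N => (hit_count hitb N)%:R) P nk).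
- by move=> N M NM; rewrite ler_nat hit_count_mono.
- by [].
- exact: density_sum_mono.
- exact: P_gt0.
- by move=> k; exact: sparse_time_gt.
- have -> : (fun k => (hit_count hitb (nk k))%:R / P (nk k)) =
     (fun k => (\sum_(i < nk k) dev_seq i) / P (nk k) + 1).
    apply/funext => k; have P0 := P_gt0 k.
    have -> : (hit_count hitb (nk k))%:R = \sum_(i < nk k) dev_seq i + P (nk k).
      rewrite /hit_count natr_sum /density_sum -big_split; apply: eq_bigr => i _ /=.
      by rewrite /dev_seq subrK.
    by rewrite mulrDl mulfV // gt_eqF.
  rewrite -[X in _ --> X]add0r; apply: cvgD; [exact: dev_seq_sums|exact: cvg_cst].
- exact: density_sum_sparse_ratio.
Qed.

Lemma hit_count_unbounded M : exists N, (M <= hit_count hitb N)%N.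
Proof.
have /cvgrPdist_le /(_ 2^-1) h1 := hit_count_ratio.
have /cvgryPge /(_ (2 * M%:R + 1)) h2 := density_sum_cvg a_gt0 a_lt1.
have {}h1 := h1 ltac:(by rewrite invr_gt0).
have [N [h3 h4]] : exists N, `|1 - (hit_count hitb N)%:R / P N| <= 2^-1 /\ 2 * M%:R + 1 <= P N.
  have [N1 _ k1] := h1; have [N2 _ k2] := h2.
  by exists (maxn N1 N2); split; [apply: k1 => /=; rewrite leq_maxl|apply: k2 => /=; rewrite leq_maxr].
exists N; rewrite -(ler_nat R).
have M0 : 0 <= M%:R :> R by [].
have P0 : 0 < P N by lra.
move: h3; rewrite ler_norml => /andP[_]; rewrite lerBlDr -lerBlDl => h3.
have : 1 / 2 <= (hit_count hitb N)%:R / P N by lra.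
by rewrite ler_pdivlMr //; lra.
Qed.

Definition hit_seq : nat -> nat := hit_enum hit_count_unbounded.

Section system.
Context (d : measure_display) (X : measurableType d).
Variables (mu : probability X R) (T : X -> X).
Hypothesis mp : measure_preserving mu T.
Let mT : measurable_fun setT T := mp.1.

(** By [int_weighted_sq] the squared norms are summable along the sparse
    times. *)
Lemma ae_dev_seq_sums (f : X -> R) : sqint mu f ->
  {ae mu, forall x, (\sum_(i < nk k) dev_seq i * f (iter i.+1 T x)) / P (nk k) @[k --> \oo] --> 0}.
Proof.
move=> sf.
pose G N x := \sum_(i < N) dev_seq i * f (iter i.+1 T x).
have mG N : measurable_fun setT (G N).
  apply: measurable_sum => i; apply: measurable_funM => //.
  exact: (measurableT_comp sf.1 (measurable_iterT i.+1 mT)).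
pose v k x := (G (nk k) x / P (nk k)) ^+ 2.
have F0 : 0 <= \int[mu]_x f x ^+ 2 by apply: Rintegral_ge0 => x _; exact: sqr_ge0.
have := @ae_bounded_sums _ _ _ mu setT v (2 * (\int[mu]_x f x ^+ 2) * B) measurableT.
case.
- by move=> k; apply: measurable_funX; apply: measurable_funM.
- by move=> k x _; exact: sqr_ge0.
- move=> K.
  apply: (@le_trans _ _ (\sum_(k < K) (2 * (\int[mu]_x f x ^+ 2) * (autocov_seq (nk k) / P (nk k) ^+ 2))%:E)%E).
    apply: lee_sum => k _.
    have P0 := P_gt0 k.
    have -> : (\int[mu]_x (v k x)%:E = (P (nk k) ^- 2)%:E * \int[mu]_x ((G (nk k) x) ^+ 2)%:E)%E.
      rewrite -ge0_integralZl //.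
      - by apply: eq_integral => x _; rewrite -EFinM /v expr_div_n mulrC.
      - by apply/measurable_EFinP; exact: measurable_funX.
      - by move=> x _; rewrite lee_fin sqr_ge0.
      - by rewrite lee_fin invr_ge0 sqr_ge0.
    apply: (@le_trans _ _ ((P (nk k) ^- 2)%:E * (2 * (\int[mu]_x f x ^+ 2) * autocov_seq (nk k))%:E)%E).
      by apply: lee_wpmul2l; [rewrite lee_fin invr_ge0 sqr_ge0|exact: int_weighted_sq].
    by rewrite -EFinM lee_fin mulrC mulrA.
  rewrite sumEFin lee_fin -mulr_sumr ler_wpM2l // mulr_ge0 //.
move=> N [mN N0 sub]; exists N; split=> // x /= nx; apply: sub => /= h; apply: nx.
have [C hC] := h I.
apply: cvg0_of_sqr; apply: (@cvg0_bounded_sums _ _ C) => //.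
by move=> k; exact: sqr_ge0.
Qed.

Lemma avg_hit_seq (f : X -> R) M x :
  ergodic_average T hit_seq f M x =
  (\sum_(i < hit_seq M) (hitb i)%:R * f (iter i.+1 T x)) / (hit_count hitb (hit_seq M))%:R.
Proof.
rewrite /hit_seq hit_count_hit_enum (sum_hits _ (fun i => f (iter i.+1 T x))) /ergodic_average sum_from1 mulrC.
by congr (_ / _); apply: eq_bigr => i _; rewrite prednK // hit_enumS_pos.
Qed.

(** Nonnegativity makes the sum over the hits nondecreasing in [N], which
    interpolation between the sparse times requires. *)
Lemma ae_avg_hit_seq_ge0 (f : X -> R) : sqint mu f -> (forall x, 0 <= f x) ->
  {ae mu, forall x, forall L : R, ergodic_average T id f N x @[N --> \oo] --> L ->
    ergodic_average T hit_seq f N x @[N --> \oo] --> L}.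
Proof.
move=> sf f0; move: (ae_dev_seq_sums sf); apply: filterS => x hdev L hL.
pose Y N := \sum_(i < N) (hitb i)%:R * f (iter i.+1 T x).
have pd i : 0 <= p i.+1 <= p i by rewrite (ltW (density_gt0 _ _)) density_le.
have hw : (P N)^-1 * \sum_(i < N) p i * f (iter i.+1 T x) @[N --> \oo] --> L.
  have hL' : N%:R^-1 * \sum_(i < N) f (iter i.+1 T x) @[N --> \oo] --> L.
    by move: hL; under eq_fun do rewrite /ergodic_average sum_from1.
  exact: (@weighted_cvg R p (fun i => f (iter i.+1 T x)) L pd (density_sum_cvg a_gt0 a_lt1) hL').
have nk_oo : nk k @[k --> \oo] --> \oo.
  move=> A [N _ hN]; exists N => // k /= Nk; apply: hN => /=.
  by rewrite (leq_trans Nk) // ltnW // sparse_time_gt.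
have hwk := cvg_comp _ _ nk_oo hw.
have YL : Y N / P N @[N --> \oo] --> L.
  apply: (@interpolate_cvg _ Y P nk).
  - move=> N M; apply: (@sum_mono _ (fun i => (hitb i)%:R * f (iter i.+1 T x))) => i.
    by rewrite mulr_ge0.
  - by move=> N; apply: sumr_ge0 => i _; rewrite mulr_ge0.
  - exact: density_sum_mono.
  - exact: P_gt0.
  - by move=> k; exact: sparse_time_gt.
  - rewrite -[L]add0r.
    have -> : (fun k => Y (nk k) / P (nk k)) = (fun k => (\sum_(i < nk k) dev_seq i * f (iter i.+1 T x)) / P (nk k)
       + (P (nk k))^-1 * \sum_(i < nk k) p i * f (iter i.+1 T x)).
      by apply/funext => k; rewrite /Y (sum_hit_split _ (fun i => f (iter i.+1 T x))) mulrDl [X in _ + X]mulrC.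
    exact: cvgD.
  - exact: density_sum_sparse_ratio.
have YR : Y N / (hit_count hitb N)%:R @[N --> \oo] --> L.
  have h : (Y N / P N) * ((hit_count hitb N)%:R / P N)^-1 @[N --> \oo] --> L.
    rewrite -[L]mulr1 -[X in _ * X]invr1.
    by apply: cvgM => //; apply: cvgV => //; exact: hit_count_ratio.
  apply: cvg_trans h; apply: near_eq_cvg.
  have /cvgryPge /(_ 1) := density_sum_cvg a_gt0 a_lt1; apply: filterS => N P1.
  have P0 : P N != 0 by rewrite gt_eqF // (lt_le_trans ltr01).
  by rewrite /= invf_div mulrA divfK.
have oo : hit_seq M @[M --> \oo] --> \oo.
  move=> A [N _ hN]; exists N => // k /= Nk; apply: hN => /=.
  by rewrite (leq_trans Nk) // hit_enum_ge_id.
have := cvg_comp _ _ oo YR.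
by under [in X in _ -> X]eq_fun do rewrite avg_hit_seq.
Qed.

Lemma sqint_le (f g : X -> R) : sqint mu f -> measurable_fun setT g ->
  (forall x, `|g x| <= `|f x|) -> sqint mu g.
Proof.
move=> [mf f2] mg gf; split=> //; apply: le_lt_trans f2.
apply: ge0_le_integral => //.
- by move=> x _; rewrite lee_fin sqr_ge0.
- by apply/measurable_EFinP; exact: measurable_funX.
- by apply/measurable_EFinP; exact: measurable_funX.
- move=> x _; rewrite lee_fin -[g x ^+ 2]real_normK ?num_real // -[f x ^+ 2]real_normK ?num_real //.
  by rewrite lerXn2r ?nnegrE.
Qed.

Lemma sqint_birkhoff (f : X -> R) : sqint mu f ->
  exists2 g : X -> R, measurable_fun setT g &
    {ae mu, forall x, ergodic_average T id f N x @[N --> \oo] --> g x}.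
Proof. by move=> sf; apply: birkhoff_limit => //; apply: sq_integrable_integrable; [exact: sf.1|exact: sf.2]. Qed.

(** Positive and negative parts are treated separately; Birkhoff's theorem
    provides a limit for each of them, and the difference of the two limits
    has to be [g]. *)
Lemma ae_avg_hit_seq (f g : X -> R) : sqint mu f ->
  {ae mu, forall x, ergodic_average T id f N x @[N --> \oo] --> g x} ->
  {ae mu, forall x, ergodic_average T hit_seq f N x @[N --> \oo] --> g x}.
Proof.
move=> sf fg; have mf := sf.1.
pose fp x := Num.max (f x) 0; pose fn x := Num.max (- f x) 0.
have fE x : f x = fp x - fn x.
  rewrite /fp /fn; case: (leP (f x) 0) => h.
    by rewrite (max_idPl _) ?sub0r ?opprK // oppr_ge0.
  by rewrite (max_idPr _) ?subr0 // oppr_le0 ltW.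
have sp : sqint mu fp.
  apply: (sqint_le sf); first exact: measurable_maxr.
  move=> x; rewrite /fp; case: (leP (f x) 0) => h //.
  by rewrite normr0.
have sn : sqint mu fn.
  apply: (sqint_le sf); first by apply: measurable_maxr => //; exact: measurable_funN.
  move=> x; rewrite /fn; case: (leP (- f x) 0) => h; first by rewrite normr0.
  by rewrite normrN.
have [gp _ hp] := sqint_birkhoff sp; have [gn _ hn] := sqint_birkhoff sn.
have tp := ae_avg_hit_seq_ge0 sp (fun x => ltac:(by rewrite /fp le_max lexx orbT)).
have tn := ae_avg_hit_seq_ge0 sn (fun x => ltac:(by rewrite /fn le_max lexx orbT)).
have E s N x : ergodic_average T s f N x = ergodic_average T s fp N x - ergodic_average T s fn N x.
  by rewrite -avgB; congr (ergodic_average T s _ N x); apply/funext => z; exact: fE.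
have gE : {ae mu, forall x, g x = gp x - gn x}.
  move: fg hp hn; apply: filterS3 => x hg h1 h2.
  apply: (cvg_unique (@Rhausdorff R) hg).
  have h : ergodic_average T id f N x @[N --> \oo] --> gp x - gn x.
    by under eq_fun do rewrite E; exact: cvgB.
  exact: h.
have tp' : {ae mu, forall x, ergodic_average T hit_seq fp N x @[N --> \oo] --> gp x}.
  by move: tp hp; apply: filterS2 => x t h; exact: t.
have tn' : {ae mu, forall x, ergodic_average T hit_seq fn N x @[N --> \oo] --> gn x}.
  by move: tn hn; apply: filterS2 => x t h; exact: t.
move: gE tp' tn'; apply: filterS3 => x -> h1 h2.
by under eq_fun do rewrite E; exact: cvgB.
Qed.

End system.
End deterministic.

Lemma Lnorm2_cvg0 (R : realType) (d : measure_display) (X : measurableType d)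
    (mu : {measure set X -> \bar R}) (v : nat -> X -> R) :
  (\int[mu]_x ((v N x) ^+ 2)%:E)%E @[N --> \oo] --> 0%E ->
  Lnorm mu 2%:E (fun x => (v N x)%:E) @[N --> \oo] --> 0%E.
Proof.
have i0 N : (0 <= \int[mu]_x ((v N x) ^+ 2)%:E)%E.
  by apply: integral_ge0 => x _; rewrite lee_fin sqr_ge0.
move=> /cvge0P h; apply/cvge0P; first by move=> N; exact: Lnorm_ge0.
move=> e e0; have e2 : 0 < e ^+ 2 by rewrite exprn_gt0.
apply: filterS (h i0 _ e2) => N hN; rewrite unlock.
have -> : (\int[mu]_x (`|(v N x)%:E| `^ 2) = \int[mu]_x ((v N x) ^+ 2)%:E)%E.
  apply: eq_integral => x _; rewrite /= powR_mulrn //.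
  by rewrite real_normK ?num_real.
have -> : e%:E = ((e ^+ 2)%:E `^ 2^-1)%E.
  by rewrite poweR_EFin -powR_mulrn ?(ltW e0) // -powRrM mulfV // powRr1 // ltW.
apply: gt0_ler_poweR => //; rewrite in_itv /= ?leey ?andbT //.
by rewrite lee_fin ltW.
Qed.

(** * Almost every starting point *)

Section sampling.
Variables (R : realType) (a delta c : R) (u : nat -> R) (A : nat -> set R).
Variables (J : nat -> nat -> interval R) (l : nat).
Hypotheses (a_gt0 : 0 < a) (delta_ge0 : 0 <= delta) (a_delta : 2 * a + delta < 1).
Hypotheses (u_gt0 : forall i, 0 < u i) (c_gt0 : 0 < c) (c_lt1 : c < 1).
Hypothesis u_step : forall i, 1 + c * i.+1%:R `^ (- delta) <= u i.+1 / u i.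
Hypothesis A_itv : forall i, A i = \bigcup_(k < l) [set` J i k].
Hypothesis A_sub : forall i, A i `<=` `[0, 1].
Hypothesis A_meas : forall i, lebesgue_measure (A i) = (i.+1%:R `^ (- a))%:E.

(** The mean of the [k]-th term is at most [C * (k + 1) `^ (- (m * eps))],
    and [m * eps >= 2]. The exceptional set of [y] is settled here, before
    any system is given. *)
Lemma ae_summable_autocov : exists2 m : nat, (0 < m)%N &
  {ae lebesgue_measure, forall y : R, y \in `[0, 1] -> exists B : R,
    forall K, \sum_(k < K) autocov_sum a u A (sparse_time m k) y / density_sum a (sparse_time m k) ^+ 2 <= B}.
Proof.
have a_lt1 : a < 1 by move: a_delta delta_ge0 a_gt0; lra.
have [C [C0 hC]] := E_autocov_sum a_gt0 delta_ge0 a_delta u_gt0 c_gt0 c_lt1 u_step A_itv A_sub A_meas.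
set eps := (1 - 2 * a - delta) / 3 in hC.
have e0 : 0 < eps by rewrite /eps divr_gt0 //; move: a_delta; lra.
pose m := (Num.truncn (2 / eps)).+1.
have me : 2 <= m%:R * eps by rewrite -ler_pdivrMr // ltW // truncnS_gt.
exists m => //.
pose v k y := autocov_sum a u A (sparse_time m k) y / density_sum a (sparse_time m k) ^+ 2.
have Q0 N y : 0 <= autocov_sum a u A N y by apply: sumr_ge0.
have nQ N := @bmeas_autocov_sum _ _ u _ _ _ A_itv A_meas N.
have nv k : bmeas (v k) by apply: bmeasM; [exact: nQ|exact: bmeas_cst].
have Ev k : \int[lebesgue_measure]_(y in `[0, 1]) v k y <= C * k.+1%:R ^- 2.
  have n0 : 0 < (sparse_time m k)%:R :> R by rewrite ltr0n sparse_time_gt0.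
  rewrite /v; under eq_Rintegral do rewrite mulrC.
  rewrite (Rint01Z _ (nQ (sparse_time m k))).
  have h1 := hC _ (sparse_time_gt0 m k).
  set n : R := (sparse_time m k)%:R in n0 h1.
  have h2 : n `^ (2 - 2 * a) <= density_sum a (sparse_time m k) ^+ 2.
    have -> : 2 - 2 * a = (1 - a) + (1 - a) by ring.
    rewrite powRD ?(gt_eqF n0) ?implybT // -expr2 lerXn2r ?nnegrE ?powR_ge0 ?density_sum_ge //.
    by rewrite ltW // density_sum_gt0 // sparse_time_gt0.
  apply: (@le_trans _ _ ((n `^ (2 - 2 * a))^-1 * (C * n `^ (2 - 2 * a - eps)))).
    apply: ler_pM => //.
    - by rewrite invr_ge0 sqr_ge0.
    - exact: Rintegral_ge0.
    - by rewrite lef_pV2 ?posrE ?powR_gt0 // (lt_le_trans _ h2) // powR_gt0.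
  rewrite mulrCA ler_wpM2l ?(ltW C0) // -powRN -powRD ?(gt_eqF n0) ?implybT //.
  have -> : - (2 - 2 * a) + (2 - 2 * a - eps) = - eps by ring.
  rewrite powRN lef_pV2 ?posrE ?powR_gt0 ?exprn_gt0 //.
  rewrite /n /sparse_time natrX -!powR_mulrn // -powRrM ler_powR //.
  by rewrite ler1n.
have := @ae_bounded_sums _ _ _ (@lebesgue_measure R) `[0, 1]%classic v (C * 2) (measurable_itv _).
case.
- by move=> k; apply: (measurable_funS measurableT) => //; exact: (nv k).1.
- by move=> k x _; rewrite divr_ge0 // sqr_ge0.
- move=> K; apply: (@le_trans _ _ (\sum_(k < K) (C * k.+1%:R ^- 2)%:E)%E).
    apply: lee_sum => k _.
    have Iv := bmeas_integrable 0 1 true false (nv k).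
    have e := Ev k; rewrite -lee_fin in e; apply: le_trans e; rewrite /Rintegral fineK //; exact: integrable_fin_num.
  by rewrite sumEFin lee_fin -mulr_sumr ler_wpM2l ?sum_inv_sq // ltW.
by move=> N [mN N0 sub]; exists N.
Qed.

Lemma autocov_seqE N y :
  autocov_seq a (fun i => frac_part (u i * y) \in A i) N = autocov_sum a u A N y.
Proof.
apply: eq_bigr => h _; congr (`|_|); apply: eq_bigr => i _.
Qed.

End sampling.

Lemma Lfun2_sqint (R : realType) (d : measure_display) (X : measurableType d)
    (mu : probability X R) (f : X -> R) : f \in Lfun mu 2%:E -> sqint mu f.
Proof.
move=> fL; split; first by have := sub_Lfun_mfun fL; rewrite inE.
have /integrableP[_] := Lfun2_integrable_sqr fL.
by under eq_integral do rewrite /= ger0_norm ?sqr_ge0 //.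
Qed.

Theorem theoremB (R : realType) (a delta : R)
  (a_gt0 : 0 < a) (delta_ge0 : 0 <= delta) (a_delta : 2 * a + delta < 1)
  (u : nat -> R) (u_sublac : sublacunary delta u)
  (I : nat -> set R)
  (I_sub : forall n, (0 < n)%N -> I n `<=` `[0, 1])
  (I_meas : forall n, (0 < n)%N ->
     lebesgue_measure (I n) = (n%:R `^ (- a))%:E)
  (I_itv : exists2 l : nat, (0 < l)%N &
     forall n, (0 < n)%N -> union_of_intervals l (I n)) :
  {ae lebesgue_measure, forall y : R, y \in `[0, 1] ->
    exists s : nat -> nat,
      [/\ increasing_enumeration (hitting_times u I y) s,
          pointwise_universally_good (2%:E : \bar R) s,
          ergodic_sequence R s &
          forall (d : measure_display) (X : measurableType d)
            (mu : probability X R) (T : X -> X), measure_preserving mu T ->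
          forall f : X -> R, f \in Lfun mu 2%:E ->
          exists2 g : X -> R, is_cond_exp mu (invariant_sets mu T) f g &
            {ae mu, forall x,
              ergodic_average T s f N x @[N --> \oo] --> g x}]}.
Proof.
have [u_gt0 [c [c_gt0 c_lt1 u_step]]] := u_sublac.
have [l _ hI] := I_itv.
have /choice[J hJ] : forall i, exists J : nat -> interval R, I i.+1 = \bigcup_(k < l) [set` J k].
  by move=> i; exact: hI.
pose v i := u i.+1; pose A i := I i.+1.
have [m m0 hB] := @ae_summable_autocov R a delta c v A J l a_gt0 delta_ge0 a_delta
  (fun i => u_gt0 i.+1 isT) c_gt0 c_lt1 (fun i => u_step i.+1 isT) hJ
  (fun i => @I_sub i.+1 isT) (fun i => @I_meas i.+1 isT).
case: hB => N [mN N0 sub]; exists N; split=> // y /= ny; apply: sub => /= hy; apply: ny => y01.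
have [B {}hB] := hy y01.
have a_lt1 : a < 1 by move: a_delta delta_ge0 a_gt0; lra.
pose hitb i := frac_part (v i * y) \in A i.
have summ K : \sum_(k < K) autocov_seq a hitb (sparse_time m k) / density_sum a (sparse_time m k) ^+ 2 <= B.
  by under eq_bigr do rewrite autocov_seqE; exact: hB.
pose s := hit_seq a_gt0 a_lt1 m0 summ.
(* [summ] is the only property of [y] that is used below, so one null set
   serves all systems *)
have main (d : measure_display) (X : measurableType d) (mu : probability X R) (T : X -> X) :
    measure_preserving mu T -> forall f : X -> R, sqint mu f ->
    exists g : X -> R, [/\ measurable_fun setT g, is_cond_exp mu (invariant_sets mu T) f g &
      {ae mu, forall x, ergodic_average T s f N x @[N --> \oo] --> g x}].
  move=> mp f sf; have [g mg hg] := sqint_birkhoff mp sf.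
  exists g; split=> //; last exact: ae_avg_hit_seq.
  by apply: is_cond_exp_birkhoff => //; [exact: sf.1|exact: sf.2].
exists s; split.
- split.
    by move=> n _; exact: hit_enum_lt.
  apply/seteqP; split=> n /=.
    move=> [[//|k] _ <-]; rewrite /s /hit_seq.
    split; first exact: hit_enumS_pos.
    have := hit_hit_enum (hit_count_unbounded a_gt0 a_lt1 m0 summ) k.
    by rewrite /hitb inE /A /v prednK // hit_enumS_pos.
  case: n => [[]//|n [_ hn]].
  have hn' : hitb n by rewrite /hitb inE.
  exists (hit_count hitb n.+1); first by rewrite hit_countS hn' addn1.
  exact: hit_enum_hit.
- move=> d X mu T mp f /Lfun2_sqint sf.
  have [g [_ _ hg]] := main d X mu T mp f sf.
  by apply: filterS hg => x hx; apply/cvg_ex; exists (g x).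
- move=> d X mu T mp f /Lfun2_sqint sf.
  have [g [mg cg hg]] := main d X mu T mp f sf.
  exists g => //; apply: Lnorm2_cvg0; apply: avg_cvg_L2 => //; [|exact: sf.1|exact: sf.2].
  move=> h M mh hM; have sh : sqint mu h.
    split=> //; apply: (@le_lt_trans _ _ (\int[mu]_x (cst ((M%:R ^+ 2 : R)%:E) x))%E).
      apply: ge0_le_integral => //.
      - by move=> x _; rewrite lee_fin sqr_ge0.
      - by apply/measurable_EFinP; exact: measurable_funX.
      - by move=> x _; rewrite lee_fin -[h x ^+ 2]real_normK ?num_real // lerXn2r ?nnegrE.
    by rewrite integral_cst //= probability_setT mule1 ltey.
  have [k [mk _ hk]] := main d X mu T mp h sh.
  by exists k.
- move=> d X mu T mp f /Lfun2_sqint sf.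
  by have [g [_ cg hg]] := main d X mu T mp f sf; exists g.
Qed.
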